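(* (a) Let $B$ be a standard Borel space and $\omega \in \mathcal{P}B$. The formation of relative product measures $(p,q) \mapsto p \otimes_\omega q$ is the only family of maps of sets $$\alpha_{X,Y} : \mathcal{P}^\omega X \times \mathcal{P}^\omega Y \longrightarrow \mathcal{P}^\omega(X \times_B Y),$$ indexed by pairs of objects $X, Y$ of $\mathsf{BorelMeas}/B$, which is natural in $X, Y \in \mathsf{BorelMeas}/B$. That is: the relative product family is natural, and if $(\alpha_{X,Y})$ is any natural family, then $\alpha_{X,Y}(p,q) = p \otimes_\omega q$ for all $X, Y \in \mathsf{BorelMeas}/B$ and all $p \in \mathcal{P}^\omega X$, $q \in \mathcal{P}^\omega Y$. (b) The analogous statement holds for discrete distributions: for any set $B$ and $\omega \in \mathcal{D}B$, the formation of relative product distributions is the only family of maps $\mathcal{D}^\omega X \times \mathcal{D}^\omega Y \to \mathcal{D}^\omega(X \times_B Y)$ natural in $X, Y \in \mathsf{Set}/B$; and for any finite set $B$ and $\omega \in \mathcal{D}_{\mathrm{fin}}B$, it is the only family of maps $\mathcal{D}_{\mathrm{fin}}^\omega X \times \mathcal{D}_{\mathrm{fin}}^\omega Y \to \mathcal{D}_{\mathrm{fin}}^\omega(X \times_B Y)$ natural in $X, Y \in \mathsf{FinSet}/B$.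
   Context: $\mathsf{BorelMeas}$ is the category of standard Borel spaces and measurable maps; $\mathsf{Set}$, $\mathsf{FinSet}$ are the categories of sets and finite sets. For a category $\mathsf{C}$ and an object $B$, the slice category $\mathsf{C}/B$ has as objects pairs $(X,\rho_X)$ with $\rho_X : X \to B$ a morphism of $\mathsf{C}$ (often written just $X$), and as morphisms $f : (X,\rho_X) \to (X',\rho_{X'})$ the morphisms $f : X \to X'$ with $\rho_{X'} \circ f = \rho_X$. The product in $\mathsf{C}/B$ is the pullback $X \times_B Y = \{(x,y) \in X \times Y : \rho_X(x) = \rho_Y(y)\}$, which in $\mathsf{BorelMeas}$ is a measurable subset of $X \times Y$ (with the induced $\sigma$-algebra), with structure map to $B$ given by $\rho_X \circ \pi_X = \rho_Y \circ \pi_Y$. $\mathcal{P}X$ is the set of probability measures on $X$, and for a measurable map $f$, $(f_\ast p)(S) = p(f^{-1}(S))$. For fixed $\omega \in \mathcal{P}B$, $\mathcal{P}^\omega(X,\rho_X) = \{p \in \mathcal{P}X : (\rho_X)_\ast p = \omega\}$, with morphisms acting by pushforward. $\mathcal{D}X$ is the set of finitely supported functions $p : X \to [0,1]$ with $\sum_{x} p(x) = 1$, regarded as probability measures on the power set of $X$, and $\mathcal{D}$ acts on functions by pushforward; $\mathcal{D}_{\mathrm{fin}}$ is the restriction of $\mathcal{D}$ to finite sets. For $\omega \in \mathcal{D}B$, $\mathcal{D}^\omega(X,\rho_X) = \{p \in \mathcal{D}X : (\rho_X)_\ast p = \omega\}$, and likewise for $\mathcal{D}_{\mathrm{fin}}^\omega$.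 A regular conditional probability of $p \in \mathcal{P}^\omega X$ with respect to $\rho_X$ is a Markov kernel $b \mapsto p(-|b)$ from $B$ to $X$ (each $p(-|b)$ is a probability measure on $X$, and $b \mapsto p(S|b)$ is measurable for each $S \in \Sigma_X$) such that $p(S \cap \rho_X^{-1}(T)) = \int_T p(S|b)\,\omega(\mathrm{d}b)$ for all $S \in \Sigma_X$, $T \in \Sigma_B$. For standard Borel $X$ and $B$ it exists and is unique up to $\omega$-a.e. equality. For $p \in \mathcal{P}^\omega X$ and $q \in \mathcal{P}^\omega Y$, the relative product is the probability measure on $X \times Y$ given by $$(p \otimes_\omega q)(S) = \int_B \bigl(p(-|b) \otimes q(-|b)\bigr)(S)\,\omega(\mathrm{d}b), \qquad S \in \Sigma_{X \times Y},$$ where $\otimes$ on the right is the ordinary product measure; it is supported on $X \times_B Y$ and regarded as a probability measure on $X \times_B Y$. In the discrete case, $(p \otimes_\omega q)(x,y) = \frac{p(x)\,q(y)}{\omega(\rho_X(x))}$ if $\rho_X(x) = \rho_Y(y)$ and $\omega(\rho_X(x)) > 0$, and $0$ otherwise. A family $\alpha_{X,Y}$ as in the claim is natural if for all morphisms $f : X \to X'$, $g : Y \to Y'$ in the slice category and all $p, q$, one has $(f \times_B g)_\ast\, \alpha_{X,Y}(p,q) = \alpha_{X',Y'}(f_\ast p, g_\ast q)$, where $f \times_B g : X \times_B Y \to X' \times_B Y'$ is the restriction of $f \times g$. *)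

(* Defs.v *)
From HB Require Import structures.
From mathcomp Require Import all_boot all_order all_algebra.
From mathcomp Require Import all_classical all_reals all_analysis.

Set Implicit Arguments.
Unset Strict Implicit.
Unset Printing Implicit Defensive.

Import Order.TTheory GRing.Theory Num.Theory.
Import numFieldNormedType.Exports.

Local Open Scope classical_set_scope.
Local Open Scope ring_scope.

(* Library measurable types are pointed, hence inhabited, whereas a fibre
   product over [B] (and an object of the slice category) may be empty.  A
   measurable space is therefore presented as a measurable subset [D] of a
   measurable type [T], with the trace sigma-algebra, i.e. the measurable sets
   contained in [D]; every measurable space arises in this way, the empty one
   with [D = set0].  A measurable map [D -> D'] is a function [f : T -> T'] with
   [measurable_fun D f] sending [D] into [D'] (its values off [D] are
   irrelevant), and a probability measure on [D] is one on [T] giving mass [1]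
   to [D]. *)

Section StandardBorel.
Variable R : realType.

Definition polish (P : metricType R) : Prop :=
  (forall F : set_system P, ProperFilter F -> cauchy F ->
     exists x : P, F --> x) /\
  (exists2 S : set P, countable S & dense S).

(* [g] is an isomorphism from [P] with its Borel sets onto [D] with its trace
   sigma-algebra. *)
Definition standard_borel d (T : measurableType d) (D : set T) : Prop :=
  exists P : metricType R, polish P /\
  exists g : P -> T, set_bij [set: P] D g /\
    forall A : set T, A `<=` D -> (measurable A <-> <<s open >> (g @^-1` A)).

Lemma measurable_diagonal d (T : measurableType d) :
  standard_borel [set: T] -> measurable [set z : T * T | z.1 = z.2].
Proof.
move=> [P [[_ [S cS dS]] [g [[_ ginj gsurj] gm]]]].
have injg u v : g u = g v -> u = v by move=> e; apply: ginj => //; exact: in_setT.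
pose e n : R := n.+1%:R^-1.
have e0 n : 0 < e n by rewrite invr_gt0.
pose E (s : P) n : set T := g @` (ball s (e n))°.
have mE s n : measurable (E s n).
  apply/gm => //.
  have -> : g @^-1` (E s n) = (ball s (e n))°.
    apply/seteqP; split=> [u [v vB /injg <-]//|u uB]; by exists u.
  by apply: sub_sigma_algebra; exact: open_interior.
rewrite -[X in measurable X]setCK; apply: measurableC.
have -> : ~` [set z : T * T | z.1 = z.2] =
    \bigcup_(s in S) \bigcup_n (E s n `*` ~` E s n).
  apply/seteqP; split=> [[x y] /= xy|[x y] [s _ [n _ [/= Ex Ey]]] xy]; last first.
    by move: Ey; rewrite /= -xy.
  have [u _ gu] := gsurj x I; have [v _ gv] := gsurj y I.
  have uv : u != v by apply: contra_notN xy => /eqP uv; rewrite -gu -gv uv.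
  have d0 : 0 < mdist u v / 2 by rewrite divr_gt0// mdist_gt0.
  have [n en] : exists n, e n < mdist u v / 2.
    have [n _ H] := near_infty_natSinv_lt (PosNum d0).
    by exists n; exact: (H n (leqnn n)).
  have h0 : 0 < e n / 2 by rewrite divr_gt0.
  have [s [/interior_subset us Ss]] : (ball u (e n / 2))° `&` S !=set0.
    apply: dS; last exact: open_interior.
    by exists u; exact: (nbhsx_ballx u (e n / 2) h0).
  exists s => //; exists n => //; split => /=.
    exists u => //; apply: filterS (nbhsx_ballx u (e n / 2) h0) => w uw.
    by rewrite (splitr (e n)); apply: ball_triangle uw; exact: ball_sym.
  move=> [w /interior_subset sw]; rewrite -gv => /injg wv.
  move: us sw; rewrite wv !ballEmdist /= => us sv.
  have := metric_triangle u s v; apply/negP; rewrite -ltNge.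
  apply: (lt_trans (ltrD us sv)); rewrite [ltRHS]splitr ltrD//.
  by apply: le_lt_trans en; rewrite ler_pdivrMr// ler_peMr ?ltW ?ltr1n.
rewrite bigcup_set_type; apply: countable_bigcupT_measurable.
  by rewrite (eq_countable (card_setT S)).
move=> s; apply: bigcupT_measurable => n.
by apply: measurableX; [exact: mE|apply: measurableC; exact: mE].
Qed.

End StandardBorel.

Section MeasurableSlice.

Record meas_over d (B : measurableType d) := MeasOver {
  disp : measure_display;
  ambient : measurableType disp;
  dom : set ambient;
  dom_measurable : measurable dom;
  proj : ambient -> B;
  proj_measurable : measurable_fun dom proj }.
#[global] Arguments dom {d B} X _ : rename.
#[global] Arguments proj {d B} X _ : rename.

Definition is_over_map d (B : measurableType d) (X X' : meas_over B)
    (f : ambient X -> ambient X') : Prop :=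
  [/\ measurable_fun (dom X) f,
      forall x, dom X x -> dom X' (f x) &
      forall x, dom X x -> proj X' (f x) = proj X x].

(* The objects of BorelMeas / B. *)
Record borel_over (R : realType) d (B : measurableType d) := BorelOver {
  borel_over_meas :> meas_over B;
  borel_over_standard : standard_borel R (dom borel_over_meas) }.

Definition fibre_dom d (B : measurableType d) (X Y : meas_over B) :
    set (ambient X * ambient Y) :=
  [set z | [/\ dom X z.1, dom Y z.2 & proj X z.1 = proj Y z.2]].

Lemma fibre_dom_measurable (R : realType) d (B : measurableType d)
    (X Y : meas_over B) :
  standard_borel R [set: B] -> measurable (fibre_dom (X := X) (Y := Y)).
Proof.
move=> sB; have mXY : measurable (dom X `*` dom Y).
  by apply: measurableX; exact: dom_measurable.
have mr (Z : meas_over B) : measurable_fun setT (proj Z \_ (dom Z)).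
  apply/(measurable_restrictT _ (@dom_measurable _ _ Z)).
  exact: proj_measurable.
have mp := measurable_fun_pair
  (measurableT_comp (mr X) measurable_fst)
  (measurableT_comp (mr Y) (@measurable_snd _ _ (ambient X) (ambient Y))).
have := measurableI _ _ mXY (mp measurableT _ (measurable_diagonal sB)).
congr measurable; apply/seteqP; split=> z /=.
  move=> [[Xz Yz] [_]]; rewrite /patch !mem_set//.
by move=> [Xz Yz e]; split=> //; split=> //; rewrite /patch !mem_set.
Qed.

Lemma fibre_proj_measurable (R : realType) d (B : measurableType d)
    (X Y : meas_over B) (sB : standard_borel R [set: B]) :
  measurable_fun (fibre_dom (X := X) (Y := Y)) (fun z => proj X z.1).
Proof.
apply: (measurable_comp (F := dom X)) => //.
- exact: dom_measurable.
- by move=> _ [z [? ? _] <-].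
- exact: proj_measurable.
- exact: measurable_funTS.
Qed.

Definition fibre_product (R : realType) d (B : measurableType d)
    (sB : standard_borel R [set: B]) (X Y : meas_over B) : meas_over B :=
  MeasOver (fibre_dom_measurable (X := X) (Y := Y) sB)
           (fibre_proj_measurable sB).

(* Library probabilities are functions on all subsets, so two elements of
   [prob_over omega X] are the same probability measure when they agree on the
   measurable sets. *)
Record prob_over (R : realType) d (B : measurableType d)
    (omega : probability B R) (X : meas_over B) := ProbOver {
  prob_over_prob :> probability (ambient X) R;
  prob_over_dom : prob_over_prob (dom X) = 1%E;
  prob_over_proj : forall T : set B, measurable T ->
    prob_over_prob (dom X `&` proj X @^-1` T) = omega T }.

Definition is_pushforward (R : realType) d (B : measurableType d)
    (omega : probability B R) (X X' : meas_over B)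
    (f : ambient X -> ambient X')
    (p : prob_over omega X) (p' : prob_over omega X') : Prop :=
  forall S, measurable S -> p' S = p (dom X `&` f @^-1` S).

Definition is_rcp (R : realType) d (B : measurableType d)
    (omega : probability B R) (X : meas_over B) (p : prob_over omega X)
    (k : R.-pker B ~> ambient X) : Prop :=
  (forall b, k b (dom X) = 1%E) /\
  (forall S T, measurable S -> measurable T ->
     p (S `&` (dom X `&` proj X @^-1` T)) = (\int[omega]_(b in T) k b S)%E).

Definition is_relative_product (R : realType) d (B : measurableType d)
    (sB : standard_borel R [set: B]) (omega : probability B R)
    (X Y : meas_over B) (p : prob_over omega X) (q : prob_over omega Y)
    (r : prob_over omega (fibre_product sB X Y)) : Prop :=
  [/\ exists k, is_rcp p k,
      exists l, is_rcp q l &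
      forall k l, is_rcp p k -> is_rcp q l ->
        forall S : set (ambient X * ambient Y), measurable S ->
          r S = (\int[omega]_b (k b \x l b) S)%E].

Definition prob_family (R : realType) d (B : measurableType d)
    (sB : standard_borel R [set: B]) (omega : probability B R) : Type :=
  forall X Y : borel_over R B,
    prob_over omega X -> prob_over omega Y ->
    prob_over omega (fibre_product sB X Y).

(* [p'] and [q'] range over all representatives of the pushforwards.  For
   identity maps this says that [a] respects equality on measurable sets, i.e.
   that it is a family of maps between sets of probability measures. *)
Definition prob_natural (R : realType) d (B : measurableType d)
    (sB : standard_borel R [set: B]) (omega : probability B R)
    (a : prob_family sB omega) : Prop :=
  forall (X X' Y Y' : borel_over R B)
    (f : ambient X -> ambient X') (g : ambient Y -> ambient Y'),
    is_over_map f -> is_over_map g ->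
  forall (p : prob_over omega X) (p' : prob_over omega X')
    (q : prob_over omega Y) (q' : prob_over omega Y'),
    is_pushforward f p p' -> is_pushforward g q q' ->
  is_pushforward
    (X := fibre_product sB X Y) (X' := fibre_product sB X' Y')
    (fun z => (f z.1, g z.2)) (a X Y p q) (a X' Y' p' q').

End MeasurableSlice.

Section DiscreteSlice.

Record distr (R : realType) (X : Type) := Distr {
  distr_fun :> X -> R;
  distr_itv : forall x, 0 <= distr_fun x <= 1;
  distr_finite : finite_set [set x | distr_fun x != 0];
  distr_sum : \sum_(x \in [set: {classic X}]) distr_fun x = 1 }.

Definition is_dpushforward (R : realType) (X X' : Type) (f : X -> X')
    (p : distr R X) (p' : distr R X') : Prop :=
  forall y, p' y = \sum_(x \in (f @^-1` [set y] : set {classic X})) p x.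

Record set_over (B : Type) := SetOver {
  set_over_sort : Type;
  set_proj : set_over_sort -> B }.
#[global] Arguments set_proj {B} X _ : rename.

Record fin_over (B : finType) := FinOver {
  fin_over_sort : finType;
  fin_proj : fin_over_sort -> B }.

Definition set_of_fin (B : finType) (X : fin_over B) : set_over B :=
  SetOver (@fin_proj B X).

Definition dfibre_sort (B : Type) (X Y : set_over B) : Type :=
  {z : set_over_sort X * set_over_sort Y | set_proj X z.1 = set_proj Y z.2}.

Definition dfibre_product (B : Type) (X Y : set_over B) : set_over B :=
  SetOver (fun z : dfibre_sort X Y => set_proj X (sval z).1).

Lemma dfibre_map_subproof (B : Type) (X X' Y Y' : set_over B)
    (f : set_over_sort X -> set_over_sort X')
    (g : set_over_sort Y -> set_over_sort Y')
    (hf : forall x, set_proj X' (f x) = set_proj X x)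
    (hg : forall y, set_proj Y' (g y) = set_proj Y y) (z : dfibre_sort X Y) :
  set_proj X' (f (sval z).1) = set_proj Y' (g (sval z).2).
Proof. by rewrite hf hg (svalP z). Qed.

Definition dfibre_map (B : Type) (X X' Y Y' : set_over B)
    (f : set_over_sort X -> set_over_sort X')
    (g : set_over_sort Y -> set_over_sort Y')
    (hf : forall x, set_proj X' (f x) = set_proj X x)
    (hg : forall y, set_proj Y' (g y) = set_proj Y y)
    (z : dfibre_sort X Y) : dfibre_sort X' Y' :=
  exist _ (f (sval z).1, g (sval z).2) (dfibre_map_subproof hf hg z).

Record distr_over (R : realType) (B : Type) (omega : distr R B)
    (X : set_over B) := DistrOver {
  distr_over_distr :> distr R (set_over_sort X);
  distr_over_proj : is_dpushforward (set_proj X) distr_over_distr omega }.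

Definition drelative_product (R : realType) (B : Type) (omega : distr R B)
    (X Y : set_over B) (p : distr_over omega X) (q : distr_over omega Y)
    (z : dfibre_sort X Y) : R :=
  let: (x, y) := sval z in
  if 0 < omega (set_proj X x) then p x * q y / omega (set_proj X x) else 0.

(* Families and naturality over the full subcategory of Set / B on the objects
   [ob i]. *)
Definition distr_family (R : realType) (B : Type) (omega : distr R B)
    (I : Type) (ob : I -> set_over B) : Type :=
  forall i j : I, distr_over omega (ob i) -> distr_over omega (ob j) ->
    distr_over omega (dfibre_product (ob i) (ob j)).

Definition distr_natural (R : realType) (B : Type) (omega : distr R B)
    (I : Type) (ob : I -> set_over B) (a : distr_family omega ob) : Prop :=
  forall (i i' j j' : I)
    (f : set_over_sort (ob i) -> set_over_sort (ob i'))
    (g : set_over_sort (ob j) -> set_over_sort (ob j'))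
    (hf : forall x, set_proj (ob i') (f x) = set_proj (ob i) x)
    (hg : forall y, set_proj (ob j') (g y) = set_proj (ob j) y)
    (p : distr_over omega (ob i)) (p' : distr_over omega (ob i'))
    (q : distr_over omega (ob j)) (q' : distr_over omega (ob j')),
    is_dpushforward f p p' -> is_dpushforward g q q' ->
  is_dpushforward (dfibre_map hf hg) (a i j p q) (a i' j' p' q').

End DiscreteSlice.

(* Main.v *)
From HB Require Import structures.
From mathcomp Require Import all_boot all_order all_algebra.
From mathcomp Require Import all_classical all_reals all_analysis.
From mathcomp Require Import measurable_realfun giry ring lra.
Require Import Defs.

(** On a measurable rectangle [S] x [T] the relative product of [p] and [q] is
    the integral over the base of [f * g], where [f] and [g] are the conditional
    probabilities of [S] and [T] given the base point ([is_density]), and a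
    measure on a product is determined by its values on rectangles.  So
    naturality has to be shown to force these values, and conversely a natural
    family with these values has to be constructed.

    Uniqueness.  Let [a] be natural.  A measurable subset [S] of [X] defines a
    map over [B] from [X] to [B * nat], recording the base point of [x] and
    whether [x] lies in [S].  It sends [p] to a measure which depends on the
    conditional probability [f] alone ([is_pushforward_mark]); hence [a p q]
    gives the rectangle a mass [Phi f g] depending on [f] and [g] alone
    ([natural_rectE]).  Marking two disjoint sets with different tags shows that
    [Phi] is additive in each argument.  It is nonnegative, and a nonnegative
    additive functional on the measurable functions with values in [0, 1] is
    determined by its values on indicators ([additive_functional_unique]).
    On indicators there is no freedom: as [a p q] lives on the fibre product, the
    event that the base point lies in [A] may be moved from one factor to the
    other, so that [Phi \1_A g = Phi 1 (\1_A * g)], and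
    [Phi 1 \1_A = omega A] because [a p q] projects to [omega].  Therefore
    [Phi f g] is the integral of [f * g] ([natural_rectangle]).  For discrete
    distributions the same argument is carried out over one point [b0] of the
    base, where [f] and [g] become two numbers between [0] and [omega b0]
    ([natural_drelative_product]).

    Existence.  Regular conditional probabilities are constructed first
    ([rcp_exists]).  A standard Borel space is a measurable retract of the real
    line ([borel_retract]): a point is coded by the list of the balls of a
    countable family that contain it, and recovered as the limit of centres of
    such balls.  On the line, conditional distribution functions at rational
    points come from the Radon-Nikodym theorem, and the kernel is the law of the
    conditional quantile function at a uniform variable ([quantile_law]).
    Averaging the products of two such kernels gives the relative product; it is
    carried by the fibre product because countably many measurable sets separate
    the points of [B] ([relative_product_exists]).  Its naturality is checked on
    rectangles.  In the discrete case everything reduces to the computation of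
    sums over one fibre ([drelative_product_sum]). *)

Set Implicit Arguments.
Unset Strict Implicit.
Unset Printing Implicit Defensive.

Import Order.TTheory GRing.Theory Num.Theory.
Import numFieldNormedType.Exports.

Local Open Scope classical_set_scope.
Local Open Scope ring_scope.

(** * Additive functionals on functions with values in the unit interval *)
Section Functional.
Context d (B : measurableType d) (R : realType).
Implicit Types (f g : B -> R) (H : (B -> R) -> R).

Definition unit_fun f := measurable_fun [set: B] f /\ forall b, 0 <= f b <= 1.

Definition additive_functional H :=
  (forall f, unit_fun f -> 0 <= H f) /\
  (forall f g, unit_fun f -> unit_fun g -> (forall b, f b + g b <= 1) ->
     H (fun b => f b + g b) = H f + H g).

Lemma unit_fun0 : unit_fun (fun=> 0).
Proof. by split=> [|b]; [exact: measurable_cst|rewrite lexx ler01]. Qed.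

Lemma unit_fun1 : unit_fun (fun=> 1).
Proof. by split=> [|b]; [exact: measurable_cst|rewrite lexx ler01]. Qed.

Lemma unit_fun_indic A : measurable A -> unit_fun (\1_A : B -> R).
Proof.
move=> mA; split=> [|b]; first exact: measurable_indic.
by rewrite indicE; case: (_ \in _); rewrite lexx ler01.
Qed.

Lemma unit_funD f g : unit_fun f -> unit_fun g -> (forall b, f b + g b <= 1) ->
  unit_fun (fun b => f b + g b).
Proof.
move=> [mf f01] [mg g01] fg; split=> [|b]; first exact: measurable_funD.
by rewrite fg addr_ge0//; [case/andP: (f01 b)|case/andP: (g01 b)].
Qed.

Lemma unit_funM f g : unit_fun f -> unit_fun g -> unit_fun (fun b => f b * g b).
Proof.
move=> [mf f01] [mg g01]; split=> [|b]; first exact: measurable_funM.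
have /andP[f0 f1] := f01 b; have /andP[g0 g1] := g01 b.
by rewrite mulr_ge0//= mulr_ile1.
Qed.

Lemma additive_functional_le H f g : additive_functional H ->
  unit_fun f -> unit_fun g -> (forall b, f b <= g b) -> H f <= H g.
Proof.
move=> [H0 HD] uf ug fg.
have uB : unit_fun (fun b => g b - f b).
  split=> [|b]; first by apply: measurable_funB; [case: ug|case: uf].
  by have := fg b; case: uf => _ /(_ b); case: ug => _ /(_ b); lra.
have -> : g = (fun b => f b + (g b - f b)) by apply/funext => b; lra.
rewrite HD// ?lerDl ?H0// => b.
by have := fg b; case: uf => _ /(_ b); case: ug => _ /(_ b); lra.
Qed.

Lemma additive_functional_sum H (h : nat -> B -> R) n : additive_functional H ->
  (forall i, unit_fun (h i)) -> (forall b, \sum_(i < n) h i b <= 1) ->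
  H (fun b => \sum_(i < n) h i b) = \sum_(i < n) H (h i).
Proof.
move=> [H0 HD] uh; elim: n => [_|n IH le1].
  rewrite big_ord0; have u0 := unit_fun0.
  have -> : (fun b : B => \sum_(i < 0) h i b) = (fun=> 0).
    by apply/funext => b; rewrite big_ord0.
  have : H (fun=> 0 + 0) = H (fun=> 0) + H (fun=> 0).
    by apply: HD => // b; rewrite addr0 ler01.
  by rewrite addr0 => ?; lra.
have le1n b : \sum_(i < n) h i b <= 1.
  apply: le_trans (le1 b); rewrite big_ord_recr /= lerDl.
  by case: (uh n) => _ /(_ b)/andP[].
rewrite big_ord_recr /= -IH// -HD//.
- by congr H; apply/funext => b; rewrite big_ord_recr.
- split=> [|b]; first by apply: measurable_sum => i; case: (uh i).
  by rewrite le1n sumr_ge0// => i _; case: (uh i) => _ /(_ b)/andP[].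
- by move=> b; have := le1 b; rewrite big_ord_recr.
Qed.

(** The part of [f] between the heights [i / n.+1] and [i.+1 / n.+1]. *)
Let layer f (n i : nat) b :=
    Num.min (f b) (i.+1%:R / n.+1%:R) - Num.min (f b) (i%:R / n.+1%:R).

Let upper f (n i : nat) := [set b | i%:R / n.+1%:R <= f b].

Let unit_layer f n i k : unit_fun f -> (k <= n.+1)%N ->
  unit_fun (fun b => layer f n i b *+ k).
Proof.
move=> [mf f01] kn; split=> [|b].
  under eq_fun do rewrite -mulr_natr.
  apply: measurable_funM => //.
  by apply: measurable_funB; apply: measurable_minr.
have e0 : 0 < (n.+1%:R : R)^-1 by rewrite invr_gt0.
have l0 : 0 <= layer f n i b.
  rewrite /layer subr_ge0 le_min ge_min lexx /= ge_min; apply/orP; right.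
  by rewrite ler_pM2r// ler_nat.
have l1 : layer f n i b <= n.+1%:R^-1.
  rewrite /layer -(natr1 i) mulrDl mul1r.
  set e : R := n.+1%:R^-1 in e0 *; set x := i%:R * e.
  by have [] := leP (f b) (x + e); have [] := leP (f b) x; lra.
rewrite mulrn_wge0//=; apply: (le_trans (ler_wMn2r k l1)).
rewrite -(mulr_natr _ k) mulrC ler_pdivrMr ?mul1r ?ler_nat//.
Qed.

Let sum_layer f n b : unit_fun f -> \sum_(i < n.+1) layer f n i b = f b.
Proof.
move=> [_ f01]; have /andP[f0 f1] := f01 b.
rewrite -(big_mkord xpredT (fun i => layer f n i b)) telescope_sumr//.
by rewrite divff ?pnatr_eq0// mul0r (min_idPl f1) (min_idPr f0) subr0.
Qed.

Let layer_bounds f n i b : unit_fun f ->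
  \1_(upper f n i.+1) b <= layer f n i b *+ n.+1 <= \1_(upper f n i) b.
Proof.
move=> uf.
have /(_ b)/andP[l0 l1] := (unit_layer i uf (leqnn n.+1)).2.
have lt : i%:R / n.+1%:R < i.+1%:R / n.+1%:R :> R
  by rewrite ltr_pM2r ?invr_gt0 ?ltr_nat.
rewrite !indicE; apply/andP; split.
  case: (boolP (b \in _)) => //; rewrite inE /upper/= => fb.
  have fb' := le_trans (ltW lt) fb.
  rewrite /layer (min_idPr fb) (min_idPr fb') -mulrBl -natrB// subSnn mul1r.
  by rewrite -(mulr_natl n.+1%:R^-1) divff// pnatr_eq0.
case: (boolP (b \in _)) => //; rewrite notin_setE /upper/= => /negP;
  rewrite -ltNge => fb.
by rewrite /layer (min_idPl (ltW fb)) (min_idPl (ltW (lt_trans fb lt))) subrr mul0rn.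
Qed.

(** Enlarged [n.+1] times, the [i]-th layer of [f] lies between the indicators of
    [upper f n i.+1] and [upper f n i].  By positivity [n.+1] times the value at
    [f] lies between the sums of the values at these indicators, and the two sums
    telescope to a difference of at most the value at [1].  So the two
    functionals differ at [f] by at most this constant divided by [n.+1]. *)
Lemma additive_functional_unique F G : additive_functional F -> additive_functional G ->
  (forall A, measurable A -> F \1_A = G \1_A) ->
  forall f, unit_fun f -> F f = G f.
Proof.
move=> aF aG FG f uf.
have mU n i : measurable (upper f n i).
  rewrite -[upper f n i]setTI; case: uf => mf _.
  exact: (measurable_fun_ler (measurable_cst _) mf).
pose L n := \sum_(i < n.+1) F (\1_(upper f n i.+1)).
pose U n := \sum_(i < n.+1) F (\1_(upper f n i)).
have key H n : additive_functional H -> (forall A, measurable A -> F \1_A = H \1_A) ->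
    L n <= H f *+ n.+1 <= U n.
  move=> aH FH; rewrite /L /U.
  have ul i : unit_fun (layer f n i) by exact: (unit_layer i uf (isT : 1 <= n.+1)%N).
  have -> : H f = \sum_(i < n.+1) H (layer f n i).
    rewrite -additive_functional_sum//.
      by congr H; apply/funext => b; rewrite sum_layer.
    by move=> b; rewrite sum_layer//; case: uf => _ /(_ b)/andP[].
  have HM i : H (layer f n i) *+ n.+1 = H (fun b => layer f n i b *+ n.+1).
    have -> : (fun b => layer f n i b *+ n.+1) =
      (fun b => \sum_(k < n.+1) layer f n i b).
      by apply/funext => b; rewrite sumr_const card_ord.
    rewrite (additive_functional_sum (h := fun=> layer f n i))//.
      by rewrite sumr_const card_ord.
    by move=> b; rewrite sumr_const card_ord;
      case: (unit_layer i uf (leqnn n.+1)) => _ /(_ b)/andP[].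
  rewrite -sumrMnl; apply/andP; split; apply: ler_sum => i _; rewrite FH// HM.
    apply: additive_functional_le => //; first exact: unit_fun_indic.
      exact: unit_layer.
    by move=> b; case/andP: (layer_bounds n i b uf).
  apply: additive_functional_le => //; first exact: unit_layer.
    exact: unit_fun_indic.
  by move=> b; case/andP: (layer_bounds n i b uf).
have UL n : U n - L n <= F (\1_setT).
  rewrite /U /L -sumrB -(big_mkord xpredT
    (fun i => F \1_(upper f n i) - F \1_(upper f n i.+1))).
  rewrite (telescope_sumr_eq (fun i => - F \1_(upper f n i)))//; last first.
    by move=> i _; rewrite addrC opprK.
  have FT A : measurable A -> 0 <= F \1_A by move=> mA; apply: aF.1;
    exact: unit_fun_indic.
  have : F \1_(upper f n 0) <= F \1_setT.
    apply: additive_functional_le => //; try exact: unit_fun_indic.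
    by move=> b; rewrite !indicE; case: (b \in upper _ _ _); rewrite in_setT.
  by have := FT _ (mU n n.+1); lra.
apply/eqP; rewrite -subr_eq0 -normr_eq0; apply/eqP.
have dist n : `|F f - G f| *+ n.+1 <= F \1_setT.
  have := key F n aF (fun _ _ => erefl); have := key G n aG FG; have := UL n.
  rewrite -normrMn mulrnBl ler_norml.
  by move: (L n) (U n) (F f *+ _) (G f *+ _) (F _) => l u x y z; lra.
apply/eqP; rewrite eq_le normr_ge0 andbT; apply/ler_addgt0Pl => e e0; rewrite addr0.
have M0 : 0 <= F \1_setT by apply: aF.1; exact: unit_fun_indic.
have [n _ /(_ n (leqnn n))/= ne] :=
  near_infty_natSinv_lt (PosNum (divr_gt0 e0 (ltr_pwDr ltr01 M0))).
have := dist n; rewrite -mulr_natr -ler_pdivlMr// => /le_trans; apply.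
rewrite mulrC (le_trans (ler_wpM2r M0 (ltW ne)))//.
rewrite -mulrA ger_pMr// mulrC ler_pdivrMr ?mul1r ?ltr_pwDr//; lra.
Qed.
End Functional.

(** * Finitely supported distributions *)
Section FiniteSums.
Context (R : realType).

(** Big sums over an infinite set are only meaningful when their support is
    finite; this lemma cuts the index set down to a finite one. *)
Lemma fsum_supp (X : choiceType) (F : X -> R) (S A : set X) :
  (forall x, F x != 0 -> S x) -> \sum_(x \in A) F x = \sum_(x \in A `&` S) F x.
Proof.
move=> FS; apply/esym/fsbig_widen => // x [Ax nAS] /=.
by apply/eqP; apply/negP => /negP Fx; apply: nAS; split => //; exact: FS.
Qed.

Lemma fsum_fibre (X Y : choiceType) (h : X -> Y) (F : X -> R) (A : set Y) :
  finite_set [set x | F x != 0] ->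
  \sum_(y \in A) \sum_(x \in h @^-1` [set y]) F x = \sum_(x \in h @^-1` A) F x.
Proof.
move=> finF; set S := [set x | F x != 0].
have supp (B : set X) : \sum_(x \in B) F x = \sum_(x \in S) if x \in B then F x else 0.
  by rewrite (fsum_supp (S := S))// -fsbig_mkcondl.
rewrite (fsum_supp (S := h @` S)); last first.
  move=> y /eqP Fy; apply: contrapT => ny; apply: Fy.
  apply: fsbig1 => x /= hx; apply/eqP/negPn/negP => Fx.
  by apply: ny; exists x.
under eq_fsbigr do rewrite supp.
rewrite exchange_fsbig//; last exact/finite_setIr/finite_image.
rewrite supp; apply: eq_fsbigr => x /set_mem Sx.
under eq_fsbigr => y _.
  rewrite (_ : (x \in h @^-1` [set y]) = (y \in [set h x])); last first.
    by apply/idP/idP => /set_mem /= e; apply/mem_set.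
  over.
rewrite -fsbig_mkcondr; case: ifPn => [/set_mem /= Ahx|/negP nA].
  rewrite (_ : _ `&` _ = [set h x]) ?fsbig_set1//.
  by apply/seteqP; split=> [y [] //|y ->]; split => //; split => //; exists x.
rewrite (_ : _ `&` _ = set0) ?fsbig_set0// -subset0 => y [[Ay _] /= yx].
by apply: nA; apply/mem_set; rewrite /= -yx.
Qed.

Lemma fsumM (X Y : choiceType) (F : X -> R) (G : Y -> R) (A : set X) (C : set Y) :
  finite_set [set x | F x != 0] -> finite_set [set y | G y != 0] ->
  \sum_(z \in A `*` C) F z.1 * G z.2 =
  (\sum_(x \in A) F x) * (\sum_(y \in C) G y).
Proof.
move=> fF fG.
rewrite (fsum_supp (S := [set x | F x != 0] `*` [set y | G y != 0])); last first.
  by move=> z; rewrite mulf_eq0 negb_or => /andP[].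
rewrite -setXI -(pair_fsbig _ (fun x y => F x * G y)); try exact: finite_setIr.
rewrite (fsum_supp (F := F) (S := [set x | F x != 0]))//.
rewrite (fsum_supp (F := G) (S := [set y | G y != 0]))//.
rewrite mulr_fsuml; apply: eq_fsbigr => x _; by rewrite mulr_fsumr.
Qed.
End FiniteSums.

Section DistrTheory.
Context (R : realType).
Implicit Types X Y B : Type.

Lemma distr_ge0 X (p : distr R X) x : 0 <= p x.
Proof. by have /andP[] := distr_itv p x. Qed.

Lemma distr_over_eq B (omega : distr R B) (X : set_over B) (p q : distr_over omega X) :
  (forall x, p x = q x) -> p = q.
Proof.
case: p q => [[p p1 p2 p3] p4] [[q q1 q2 q3] q4] /= /funext epq; subst q.
rewrite (Prop_irrelevance p1 q1) (Prop_irrelevance p2 q2) in p3 p4 *.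
rewrite (Prop_irrelevance p3 q3) in p4 *.
by rewrite (Prop_irrelevance p4 q4).
Qed.

(** The sums over the fibres of the projection already fix the total mass,
    because [omega] has mass [1]. *)
Lemma distr_over_of_fun B (omega : distr R B) (X : set_over B) (F : set_over_sort X ->
    R) :
  (forall x, 0 <= F x) -> finite_set [set x | F x != 0] ->
  (forall b, omega b = \sum_(x \in
    (set_proj X @^-1` [set b] : set {classic (set_over_sort X)})) F x) ->
  exists p : distr_over omega X, forall x, p x = F x.
Proof.
move=> F0 finF Fom.
have F1 : \sum_(x \in [set: {classic (set_over_sort X)}]) F x = 1.
  rewrite -(distr_sum omega) -[setT](preimage_setT (set_proj X)).
  rewrite -(fsum_fibre (X := {classic (set_over_sort X)}) (Y := {classic B}))//.
  by apply: eq_fsbigr => b _; rewrite Fom.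
have F01 x : 0 <= F x <= 1.
  rewrite F0/= -F1 (fsum_supp (X := {classic (set_over_sort X)}) (S :=
    [set x] `|` [set x | F x != 0])); last by right.
  rewrite setTI (fsbigD1 (x : {classic (set_over_sort X)}))//=; first last.
  - by left.
  - by rewrite finite_setU.
  by rewrite lerDl; apply: fsumr_ge0.
by exists (@DistrOver _ _ omega X (Distr F01 finF F1) Fom).
Qed.

(** As [0^-1 = 0], the points of mass [0] need no separate treatment. *)
Lemma drelative_productE B (omega : distr R B) (X Y : set_over B)
    (p : distr_over omega X) (q : distr_over omega Y) z :
  drelative_product p q z = p (sval z).1 * q (sval z).2 / omega (set_proj X (sval z).1).
Proof.
rewrite /drelative_product; case: (sval z) => x y /=; case: ifPn => //.
by rewrite -leNgt => om0;
  rewrite (@le_anti _ _ (omega _) 0) ?invr0 ?mulr0// om0 distr_ge0.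
Qed.

(** Over one base point the denominator is constant and every pair belongs to
    the fibre product, so the sum factors.  The projection to the base and the
    naturality of the relative product are both instances. *)
Lemma drelative_product_sum B (omega : distr R B) (X Y : set_over B)
    (p : distr_over omega X) (q : distr_over omega Y) b
    (A : set {classic (set_over_sort X)}) (C : set {classic (set_over_sort Y)}) :
  (forall x, A x -> set_proj X x = b) -> (forall y, C y -> set_proj Y y = b) ->
  \sum_(z \in [set z : {classic (dfibre_sort X Y)} | A (sval z).1 /\ C (sval z).2])
     drelative_product p q z =
  (\sum_(x \in A) p x) * (\sum_(y \in C) q y) / omega b.
Proof.
move=> Ab Cb.
rewrite -(fsumM (X := {classic (set_over_sort X)}) (Y := {classic (set_over_sort Y)}));
  [|exact: distr_finite..].
rewrite mulr_fsuml.
rewrite (reindex_fsbig (sval : {classic (dfibre_sort X Y)} ->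
  ({classic (set_over_sort X)} * {classic (set_over_sort Y)})%type)
  [set z | A (sval z).1 /\ C (sval z).2]).
  apply: eq_fsbigr => z /set_mem[/= Az Cz].
  by rewrite drelative_productE Ab.
split=> [z //|z1 z2 _ _ e|[x y] [/= Ax Cy]].
  by case: z1 z2 e => [z1 h1] [z2 h2]; exact: eq_exist.
have e : set_proj X (x, y).1 = set_proj Y (x, y).2 by rewrite Ab// Cb.
by exists (exist _ (x, y) e).
Qed.

Lemma drelative_product_exists B (omega : distr R B) (X Y : set_over B)
    (p : distr_over omega X) (q : distr_over omega Y) :
  exists r : distr_over omega (dfibre_product X Y), forall z, r z =
    drelative_product p q z.
Proof.
apply: distr_over_of_fun => [z||b].
- by rewrite drelative_productE !mulr_ge0 ?invr_ge0 ?distr_ge0.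
- pose sv := (sval : {classic (dfibre_sort X Y)} ->
    ({classic (set_over_sort X)} * {classic (set_over_sort Y)})%type).
  have inj : {in sv @^-1` ([set x | p x != 0] `*` [set y | q y != 0]) &, injective sv}.
    by move=> [z1 h1] [z2 h2] _ _ /= e; apply: eq_exist.
  have := finite_preimage inj (finite_setX (distr_finite p) (distr_finite q)).
  apply: sub_finite_set => z /=; rewrite drelative_productE.
  by rewrite !mulf_eq0 !negb_or => /andP[/andP[]].
- have := @drelative_product_sum B omega X Y p q b (set_proj X @^-1` [set b])
  (set_proj Y @^-1` [set b]) (fun _ => id) (fun _ => id).
  rewrite -!(distr_over_proj _ b) => e.
  transitivity (omega b * omega b / omega b).
    have [->|b0] := eqVneq (omega b) 0; first by rewrite !mul0r.
    by rewrite mulfK.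
  rewrite -e; apply: eq_fsbigl; apply/seteqP; split=> [z [] //|[z h] /= zb];
    split => //.
  by rewrite /= -h.
Qed.

Lemma drelative_product_natural B (omega : distr R B) (X X' Y Y' : set_over B)
    (f : set_over_sort X -> set_over_sort X')
    (g : set_over_sort Y -> set_over_sort Y')
    (hf : forall x, set_proj X' (f x) = set_proj X x)
    (hg : forall y, set_proj Y' (g y) = set_proj Y y)
    (p : distr_over omega X) (p' : distr_over omega X')
    (q : distr_over omega Y) (q' : distr_over omega Y') :
  is_dpushforward f p p' -> is_dpushforward g q q' -> forall z',
  drelative_product p' q' z' =
  \sum_(z \in (dfibre_map hf hg @^-1`
    [set z'] : set {classic (dfibre_sort X Y)})) drelative_product p q z.
Proof.
move=> pp' qq' [[x' y'] e]; rewrite drelative_productE /= pp' qq'.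
rewrite -drelative_product_sum => [|x /= <-|y /= gy]; rewrite ?hf//; last first.
  by rewrite -[set_proj X' x']/(set_proj X' (x', y').1) e /= -gy hg.
apply: eq_fsbigl; apply/seteqP; split=> [z [/= fx gy]|z /= ez]; last first.
  by split; [exact: (congr1 (fun z => (sval z).1) ez)|exact:
    (congr1 (fun z => (sval z).2) ez)].
by apply: eq_exist; rewrite fx gy.
Qed.

End DistrTheory.

(** * Uniqueness for discrete distributions *)
(** After scaling to [0, 1], this is the uniqueness of additive functionals over
    a base space with one point. *)
Lemma additive_linear (R : realType) (c : R) (phi : R -> R) :
  (forall s, 0 <= s <= c -> 0 <= phi s) ->
  (forall s t, 0 <= s -> 0 <= t -> s + t <= c -> phi (s + t) = phi s + phi t) ->
  forall s, 0 <= s <= c -> phi s * c = s * phi c.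
Proof.
move=> phi0 phiD s /andP[s0 sc]; have c0 := le_trans s0 sc.
have phi00 : phi 0 = 0.
  have := phiD 0 0 (lexx 0) (lexx 0); rewrite addr0 => /(_ c0); lra.
(* The scaling divides by [c], so [c = 0] is treated apart. *)
have [c_eq0|c_neq0] := eqVneq c 0.
  have -> : s = 0 by apply/eqP; rewrite eq_le s0 -c_eq0 sc.
  by rewrite phi00 !mul0r.
pose F (f : unit -> R) := phi (f tt * c); pose G (f : unit -> R) := f tt * phi c.
have ran (f : unit -> R) : unit_fun f -> 0 <= f tt * c <= c.
  by move=> [_ /(_ tt)/andP[f0 f1]]; rewrite mulr_ge0//= ler_piMl.
have aF : additive_functional F.
  split=> [f uf|f g uf ug fg]; first exact/phi0/ran.
  have /andP[? ?] := ran _ uf; have /andP[? ?] := ran _ ug.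
  by rewrite /F mulrDl phiD// -mulrDl ler_piMl.
have aG : additive_functional G.
  split=> [f [_ /(_ tt)/andP[f0 f1]]|f g uf ug fg]; last by rewrite /G mulrDl.
  by rewrite /G mulr_ge0// phi0// c0 lexx.
have us : unit_fun (fun _ : unit => s / c).
  by split=> [|_]; [exact: measurable_cst|rewrite divr_ge0// ler_pdivrMr ?mul1r// lt_neqAle eq_sym c_neq0].
have := additive_functional_unique aF aG _ us.
rewrite /F /G divfK// => ->; first by rewrite mulrAC divfK.
by move=> A _; rewrite indicE; case: (_ \in _); rewrite ?mul1r ?mul0r.
Qed.

(** The object [z] stands for [B * 'I_3] with its first projection; it is
    described by the pairing [inj] and the second projection [idx], so that the
    argument applies both to all sets and to finite sets over [B].  Two of the
    three indices serve to split a mass into two parts, the index [0] receives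
    whatever is not marked.  Everything happens over the point [b0]. *)
Section DiscreteUniqueness.
Context (R : realType) (B : Type) (omega : distr R B) (I : Type)
  (ob : I -> set_over B) (z : I) (inj : B -> 'I_3 -> set_over_sort (ob z))
  (idx : set_over_sort (ob z) -> 'I_3).
Hypothesis proj_inj : forall b i, set_proj (ob z) (inj b i) = b.
Hypothesis idx_inj : forall b i, idx (inj b i) = i.
Hypothesis injK : forall x, inj (set_proj (ob z) x) (idx x) = x.
Variables (a : distr_family omega ob) (nat_a : distr_natural a) (b0 : B).

Let Z := set_over_sort (ob z).

Let wfun (s1 s2 : R) (x : Z) : R :=
  if `[< set_proj (ob z) x = b0 >] then
    [:: omega b0 - s1 - s2; s1; s2]`_(idx x)
  else if idx x == 0 then omega (set_proj (ob z) x) else 0.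

Let exists_weighted s1 s2 : 0 <= s1 -> 0 <= s2 -> s1 + s2 <= omega b0 ->
  exists p : distr_over omega (ob z), forall x, p x = wfun s1 s2 x.
Proof.
move=> s10 s20 s12.
have fib b (F : Z -> R) :
  \sum_(x \in (set_proj (ob z) @^-1` [set b] : set {classic Z})) F x =
    \sum_(i < 3) F (inj b i).
  rewrite (reindex_fsbig (inj b : 'I_3 -> {classic Z}) [set: 'I_3]).
    rewrite (fsbigE (enum 'I_3)) ?enum_uniq// => [|i]; last by rewrite mem_enum.
    under eq_bigl do rewrite in_setT.
    by rewrite big_enum.
  split=> [i _|i j _ _ /(congr1 idx)|x /= <-]; first exact: proj_inj.
    by rewrite !idx_inj.
  by exists (idx x).
apply: distr_over_of_fun => [x||b].
- rewrite /wfun; case: asboolP => ?; last by case: ifPn; rewrite ?distr_ge0.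
  by case: (idx x) => m /=; case: m => [|[|[|m]]] //= _; lra.
- (* The base points of the support lie in the support of [omega], up to [b0]. *)
  have fin : finite_set [set c | c = b0 \/ omega c != 0].
    by rewrite finite_setU; split; [exact: finite_set1|exact: distr_finite].
  have := finite_image (fun u : {classic B} * 'I_3 => inj u.1 u.2 : {classic Z})
    (finite_setX fin (finite_finset (X := [set: 'I_3]))).
  apply: sub_finite_set => x /= wx; exists (set_proj (ob z) x, idx x) => //=;
    split => //=.
  move: wx; rewrite /wfun; case: asboolP => [?|?]; first by left.
  by case: ifPn; [right|rewrite eqxx].
- rewrite fib !big_ord_recl big_ord0 /wfun !proj_inj !idx_inj /=.
  case: asboolP => [->|?] /=; first lra.
  by rewrite !addr0.
Qed.

Let sumD (X : choiceType) (F : X -> R) (A C : set X) : finite_set [set x | F x != 0] ->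
  \sum_(x \in A) F x = \sum_(x \in A `&` C) F x + \sum_(x \in A `\` C) F x.
Proof.
move=> finF; have E := @fsum_supp R X F [set x | F x != 0].
rewrite (E A)// (fsbigID C); last exact: finite_setIr.
by rewrite (E (A `&` C))// (E (A `\` C))// setDE setIAC (setIAC A (~` C)).
Qed.

Let Pex : exists P : R -> distr_over omega (ob z),
  forall s, 0 <= s <= omega b0 -> forall x, P s x = wfun s 0 x.
Proof.
suff /choice[P PE] : forall s, exists p : distr_over omega (ob z),
    0 <= s <= omega b0 -> forall x, p x = wfun s 0 x by exists P.
move=> s.
have [sb|nsb] := boolP (0 <= s <= omega b0).
  have [p pE] : exists p : distr_over omega (ob z), forall x, p x = wfun s 0 x.
    by case/andP: sb => ? ?; apply: exists_weighted => //; rewrite addr0.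
  by exists p.
have [p pE] : exists p : distr_over omega (ob z), forall x, p x = wfun 0 0 x.
  by apply: exists_weighted => //; rewrite addr0 distr_ge0.
by exists p.
Qed.

Let P := sval (cid Pex).
Let PE : forall s, 0 <= s <= omega b0 -> forall x, P s x = wfun s 0 x :=
    svalP (cid Pex).

Let mark (i : I) (S : set (set_over_sort (ob i))) (x : set_over_sort (ob i)) : Z :=
  inj (set_proj (ob i) x) (if `[< S x >] then 1 else 0).

Let proj_mark i S x : set_proj (ob z) (@mark i S x) = set_proj (ob i) x.
Proof. by rewrite /mark proj_inj. Qed.

Let mass_itv i (p : distr_over omega (ob i))
    (S : set {classic (set_over_sort (ob i))}) :
  (forall x, S x -> set_proj (ob i) x = b0) ->
  0 <= \sum_(x \in S) p x <= omega b0.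
Proof.
move=> Sb; rewrite fsumr_ge0/= => [|x _]; last exact: distr_ge0.
rewrite (distr_over_proj p b0) (sumD _ S (distr_finite p)) (setIidr _) => [|x /Sb//].
by rewrite lerDl fsumr_ge0// => x _; exact: distr_ge0.
Qed.

(** Marking a part [S] of the fibre over [b0] forgets everything about [p] but
    the mass of [S]. *)
Let mark_push i (p : distr_over omega (ob i))
    (S : set {classic (set_over_sort (ob i))}) :
  (forall x, S x -> set_proj (ob i) x = b0) ->
  is_dpushforward (@mark i S) p (P (\sum_(x \in S) p x)).
Proof.
move=> Sb y; rewrite PE; last exact: mass_itv.
rewrite /wfun.
have pre : @mark i S @^-1` [set y] = [set x | set_proj (ob i) x = set_proj (ob z) y
    /\ (if `[< S x >] then 1 else 0) = idx y].
  apply/seteqP; split=> [x /= <-|x /= [e1 e2]];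
    first by rewrite proj_mark /mark idx_inj.
  by rewrite /mark e1 e2 injK.
rewrite pre; case: asboolP => yb; last first.
  have nS x : set_proj (ob i) x = set_proj (ob z) y -> ~ S x.
    by move=> e /Sb; rewrite e.
  case: ifPn => y0.
    rewrite (distr_over_proj p (set_proj (ob z) y)); apply: eq_fsbigl.
    apply/seteqP; split=> x /=; last by case.
    by move=> e; split=> //; case: asboolP => [/(nS _ e)//|_]; rewrite (eqP y0).
  rewrite (_ : [set x | _] = set0) ?fsbig_set0// -subset0 => x /= [e].
  by case: asboolP => [/(nS _ e)//|_ ey]; rewrite -ey eqxx in y0.
rewrite yb; case: (idx y) => m; case: m => [|[|[|//]]] h /=.
- rewrite subr0 (distr_over_proj p b0) (sumD _ S (distr_finite p)) (setIidr _) =>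
  [|x /Sb//].
  rewrite [X in X - _]addrC addrK; apply: eq_fsbigl; apply/seteqP; split=> x /=.
    by move=> [-> nS]; split=> //; case: asboolP => // _; exact/val_inj.
  by move=> [-> e]; split=> // Sx; move: e; case: asboolP => // _ /(congr1 val).
- apply: eq_fsbigl; apply/seteqP; split=> x /=.
    by move=> Sx; split; [exact: Sb|case: asboolP => // _; exact/val_inj].
  by move=> [_]; case: asboolP => // _ /(congr1 val).
- rewrite (_ : [set x | _] = set0) ?fsbig_set0// -subset0 => x /= [_].
  by case: asboolP => _ /(congr1 val).
Qed.

Let diag : dfibre_sort (ob z) (ob z) := exist _ (inj b0 1, inj b0 1) erefl.
Let phi s t := a (P s) (P t) diag.

Let phiE i j (p : distr_over omega (ob i)) (q : distr_over omega (ob j))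
    (S : set {classic (set_over_sort (ob i))})
      (T : set {classic (set_over_sort (ob j))}) :
  (forall x, S x -> set_proj (ob i) x = b0) ->
  (forall y, T y -> set_proj (ob j) y = b0) ->
  phi (\sum_(x \in S) p x) (\sum_(y \in T) q y) =
  \sum_(v \in [set v : {classic (dfibre_sort (ob i) (ob j))} | S (sval v).1 /\ T
    (sval v).2]) a p q v.
Proof.
move=> Sb Tb; rewrite /phi.
have := nat_a (@proj_mark i S) (@proj_mark j T) (@mark_push i p S Sb)
  (@mark_push j q T Tb) => ->.
apply: eq_fsbigl; apply/seteqP; split=> [v /= e|[[x y] e] /= [Sx Ty]].
  have : idx (mark S (sval v).1) = 1
    by rewrite [mark S _](congr1 (fun v => (sval v).1) e) idx_inj.
  have : idx (mark T (sval v).2) = 1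
    by rewrite [mark T _](congr1 (fun v => (sval v).2) e) idx_inj.
  rewrite /mark !idx_inj; case: asboolP => // Tv _; case: asboolP => // Sv _.
apply: eq_exist => /=; rewrite /mark Sb// Tb//.
by case: asboolP => // _; case: asboolP.
Qed.

Let om0 : 0 <= omega b0. Proof. exact: distr_ge0. Qed.

Let phi_ge0 s t : 0 <= phi s t. Proof. exact: distr_ge0. Qed.

Let phi_diag : phi (omega b0) (omega b0) = omega b0.
Proof.
have := @phiE z z (P 0) (P 0) (set_proj (ob z) @^-1` [set b0])
  (set_proj (ob z) @^-1` [set b0]) (fun _ => id) (fun _ => id).
rewrite -!(distr_over_proj _ b0) => ->;
  rewrite [RHS](distr_over_proj (a (P 0) (P 0)) b0).
apply: eq_fsbigl; apply/seteqP; split=> [v [] //|[v h] /= vb]; split => //.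
by rewrite /= -h.
Qed.

Let mass1 s : 0 <= s <= omega b0 ->
  \sum_(x \in ([set inj b0 1] : set {classic Z})) P s x = s.
Proof.
move=> sb; rewrite fsbig_set1 PE// /wfun proj_inj idx_inj; case: asboolP => //.
Qed.

Let fin_a i j (p : distr_over omega (ob i)) (q : distr_over omega (ob j)) :=
  distr_finite (a p q).

Let mass2 s1 s2 (p : distr_over omega (ob z)) : (forall x, p x = wfun s1 s2 x) ->
  [/\ \sum_(x \in ([set inj b0 1] : set {classic Z})) p x = s1,
  \sum_(x \in ([set inj b0 2%:R] : set {classic Z})) p x = s2 &
  \sum_(x \in ([set inj b0 1; inj b0 2%:R] : set {classic Z})) p x = s1 + s2].
Proof.
move=> pE.
have neq : inj b0 2%:R != inj b0 1 :> {classic Z}.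
  by apply/eqP => /(congr1 idx); rewrite !idx_inj => /(congr1 val).
have p1 : p (inj b0 1) = s1 by rewrite pE /wfun proj_inj idx_inj; case: asboolP.
have p2 : p (inj b0 2%:R) = s2 by rewrite pE /wfun proj_inj idx_inj; case: asboolP.
rewrite fsbigU0 ?fsbig_set1 ?p1 ?p2//.
by move=> x [/= -> e]; move/eqP: neq; rewrite e.
Qed.

(** A distribution with masses [s1] and [s2] at the indices [1] and [2] yields
    [phi s1 t], [phi s2 t] or [phi (s1 + s2) t], according to which of the two
    indices are marked. *)
Let phiDl s1 s2 t : 0 <= t <= omega b0 -> 0 <= s1 -> 0 <= s2 -> s1 + s2 <= omega b0 ->
  phi (s1 + s2) t = phi s1 t + phi s2 t.
Proof.
move=> tb s10 s20 s12; have [p pE] := exists_weighted s10 s20 s12.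
have [p1 p2 p12] := mass2 pE; have tE := mass1 tb.
pose T : set {classic Z} := [set inj b0 1].
have Tb y : T y -> set_proj (ob z) y = b0 by move=> ->; rewrite proj_inj.
rewrite -p12 -p1 -p2 -[X in phi _ X]tE -[X in _ = phi _ X + _]tE -[X in _ = _ +
  phi _ X]tE.
have S1b x : [set inj b0 1] x -> set_proj (ob z) x = b0 by move=> ->; exact: proj_inj.
have S2b x : [set inj b0 2%:R] x -> set_proj (ob z) x = b0 by move=> ->;
  exact: proj_inj.
have S12b x : [set inj b0 1; inj b0 2%:R] x -> set_proj (ob z) x = b0 by case=> ->;
  exact: proj_inj.
rewrite (phiE p (P t) S12b Tb) (phiE p (P t) S1b Tb) (phiE p (P t) S2b Tb).
rewrite (@sumD {classic (dfibre_sort (ob z) (ob z))} _ _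
  [set v | (sval v).1 = inj b0 1] (fin_a _ _)).
congr (_ + _); apply: eq_fsbigl; apply/seteqP; split=> v /=.
- by move=> [[_ ?] ?].
- by move=> [? ?]; split => //; split => //; left.
- by move=> [[[]]].
- move=> [e Tv]; split; first by split => //; right.
  by rewrite e => /(congr1 idx); rewrite !idx_inj => /(congr1 val).
Qed.

Let phiDr s t1 t2 : 0 <= s <= omega b0 -> 0 <= t1 -> 0 <= t2 -> t1 + t2 <= omega b0 ->
  phi s (t1 + t2) = phi s t1 + phi s t2.
Proof.
move=> sb t10 t20 t12; have [p pE] := exists_weighted t10 t20 t12.
have [p1 p2 p12] := mass2 pE; have sE := mass1 sb.
pose S : set {classic Z} := [set inj b0 1].
have Sb y : S y -> set_proj (ob z) y = b0 by move=> ->; rewrite proj_inj.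
rewrite -p12 -p1 -p2 -[X in phi X _]sE -[X in _ = phi X _ + _]sE -[X in _ = _ +
  phi X _]sE.
have T1b x : [set inj b0 1] x -> set_proj (ob z) x = b0 by move=> ->; exact: proj_inj.
have T2b x : [set inj b0 2%:R] x -> set_proj (ob z) x = b0 by move=> ->;
  exact: proj_inj.
have T12b x : [set inj b0 1; inj b0 2%:R] x -> set_proj (ob z) x = b0 by case=> ->;
  exact: proj_inj.
rewrite (phiE (P s) p Sb T12b) (phiE (P s) p Sb T1b) (phiE (P s) p Sb T2b).
rewrite (@sumD {classic (dfibre_sort (ob z) (ob z))} _ _
  [set v | (sval v).2 = inj b0 1] (fin_a _ _)).
congr (_ + _); apply: eq_fsbigl; apply/seteqP; split=> v /=.
- by move=> [[? _] ?].
- by move=> [? ?]; split => //; split => //; left.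
- by move=> [[? []]].
- move=> [Sv e]; split; first by split => //; right.
  by rewrite e => /(congr1 idx); rewrite !idx_inj => /(congr1 val).
Qed.

(** Additivity makes [phi] bilinear on [0, omega b0], and the projection to the
    base fixes its value at the corner [(omega b0, omega b0)]. *)
Lemma natural_drelative_product i j (p : distr_over omega (ob i))
    (q : distr_over omega (ob j)) v :
  set_proj (ob i) (sval v).1 = b0 -> a p q v = drelative_product p q v.
Proof.
case: v => -[x y] e /= xb; rewrite drelative_productE /= xb.
have yb : set_proj (ob j) y = b0 by rewrite -xb.
have Sb u : [set x] u -> set_proj (ob i) u = b0 by move=> ->.
have Tb u : [set y] u -> set_proj (ob j) u = b0 by move=> ->.
have : phi (p x) (q y) = a p q (exist _ (x, y) e).
  have := phiE p q Sb Tb; rewrite !fsbig_set1 => ->.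
  rewrite (_ : [set v | _] = [set exist _ (x, y) e]) ?fsbig_set1//.
  apply/seteqP; split=> [[[u w] h] /= [ux wy]|v /= -> //].
  by apply: eq_exist; rewrite ux wy.
move=> <-.
have xI : 0 <= p x <= omega b0 by have := mass_itv p Sb; rewrite fsbig_set1.
have yI : 0 <= q y <= omega b0 by have := mass_itv q Tb; rewrite fsbig_set1.
have omI : 0 <= omega b0 <= omega b0 by rewrite om0 lexx.
have lin1 t : 0 <= t <= omega b0 -> phi (p x) t * omega b0 = p x * phi (omega b0) t.
  move=> tb; apply: (additive_linear (phi := fun s => phi s t)) => // s1 s2 ? ? ?.
  exact: phiDl.
have lin2 : phi (omega b0) (q y) * omega b0 = q y * phi (omega b0) (omega b0).
  by apply: (additive_linear (phi := phi (omega b0))) => // s1 s2 ? ? ?; exact: phiDr.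
have [om_eq0|om_neq0] := eqVneq (omega b0) 0.
  have x0 : p x = 0 by apply/eqP; rewrite eq_le -{1}om_eq0 andbC.
  have := @phiDl 0 0 (q y) yI (lexx 0) (lexx 0); rewrite addr0 => /(_ om0) => e0.
  by rewrite x0 om_eq0 invr0 mulr0; lra.
apply: (mulIf om_neq0); rewrite lin1// divfK//; apply: (mulIf om_neq0).
by rewrite -[LHS]mulrA lin2 phi_diag mulrA.
Qed.
End DiscreteUniqueness.

Theorem drelative_product_only_natural (R : realType) (B : Type) (omega : distr R B)
    (I : Type)
  (ob : I -> set_over B) (z : I) (inj : B -> 'I_3 -> set_over_sort (ob z))
  (idx : set_over_sort (ob z) -> 'I_3) :
  (forall b i, set_proj (ob z) (inj b i) = b) ->
  (forall b i, idx (inj b i) = i) ->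
  (forall x, inj (set_proj (ob z) x) (idx x) = x) ->
  exists a : distr_family omega ob,
    [/\ forall i j (p : distr_over omega (ob i)) (q : distr_over omega (ob j)) v,
          a i j p q v = drelative_product p q v,
        distr_natural a &
        forall b : distr_family omega ob, distr_natural b ->
          forall i j (p : distr_over omega (ob i)) (q : distr_over omega (ob j)),
            b i j p q = a i j p q].
Proof.
move=> pi ii ik.
exists (fun i j p q => sval (cid (drelative_product_exists p q))); split.
- by move=> i j p q v; case: cid.
- move=> i i' j j' f g hf hg p p' q q' pp' qq' y; case: cid => r rE /=.
  rewrite rE (drelative_product_natural hf hg pp' qq').
  by apply: eq_fsbigr => x _; case: cid.
- move=> b nat_b i j p q; apply: distr_over_eq => v; case: cid => r rE /=.
  by rewrite rE (natural_drelative_product pi ii ik nat_b p q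
    (erefl (set_proj (ob i) (sval v).1))).
Qed.

(** * Tools for probability measures *)
Section MeasureTools.
Context (R : realType).

Section ProbabilityOf.
Context d (T : measurableType d) (m : {measure set T -> \bar R}).

(** The proof is an argument so that it can be recovered from the term when its
    structure of probability measure is inferred. *)
Definition of_mass1 (m1 : m setT = 1%E) : set T -> \bar R := m.

Context (m1 : m setT = 1%E).
HB.instance Definition _ := Measure.on (of_mass1 m1).
HB.instance Definition _ := Measure_isProbability.Build _ _ _ (of_mass1 m1) m1.

Lemma probability_of : exists P : probability T R, forall U, P U = m U.
Proof. by exists (of_mass1 m1). Qed.
End ProbabilityOf.

Lemma probability_full d (T : measurableType d) (P : probability T R) (D A : set T) :
  measurable D -> measurable A -> P D = 1%E -> P (D `&` A) = P A.
Proof.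
move=> mD mA D1.
have D0 : P (~` D) = 0%E by rewrite probability_setC// D1 subee.
have AD0 : P (A `\` D) = 0%E.
  by apply: subset_measure0 D0; [exact: measurableD|exact: measurableC|move=> x []].
by rewrite setIC -[LHS]add0e -AD0; apply/esym; exact: measureDI.
Qed.

Lemma measurable_fun_pair_on d d1 d2 (T : measurableType d) (T1 : measurableType d1)
    (T2 : measurableType d2) (D : set T) (f : T -> T1) (g : T -> T2) :
  measurable_fun D f -> measurable_fun D g -> measurable_fun D (fun x => (f x, g x)).
Proof.
move=> mf mg mD; apply: (measurability _ (measurable_prod_measurableType T1 T2) _ mD).
move=> _ [_ [A mA [C mC <-]] <-].
have -> : D `&` (fun x => (f x, g x)) @^-1` (A `*` C) =
    (D `&` f @^-1` A) `&` (D `&` g @^-1` C).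
  by apply/seteqP; split=> [x [? []]|x [[? ?] []]].
by apply: measurableI; [exact: mf|exact: mg].
Qed.

Lemma prod_measure_ext d1 d2 (T1 : measurableType d1) (T2 : measurableType d2)
    (m1 m2 : probability (T1 * T2)%type R) :
  (forall A C, measurable A -> measurable C -> m1 (A `*` C) = m2 (A `*` C)) ->
  forall S, measurable S -> m1 S = m2 S.
Proof.
move=> E S mS.
pose G : set (set (T1 * T2)) := [set A `*` C | A in measurable & C in measurable].
apply: (measure_unique G (fun=> setT)) => //.
- exact: measurable_prod_measurableType.
- move=> _ _ [A mA [C mC <-]] [A' mA' [C' mC' <-]].
  by rewrite -setXI; exists (A `&` A');
    [exact: measurableI|exists (C `&` C') => //; exact: measurableI].
- by move=> _; exists setT => //; exists setT => //; rewrite setXTT.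
- by rewrite bigcup_const.
- by move=> _ [A mA [C mC <-]]; exact: E.
- by move=> _; rewrite [ltLHS]probability_setT ltry.
Qed.

Lemma measurable_preimage_snd d (B : measurableType d) (V : set nat) :
  measurable [set z : B * nat | V z.2].
Proof.
rewrite (_ : [set _ | _] = setT `*` V); first exact: measurableX.
by apply/seteqP; split=> [z /=|z []].
Qed.

Definition unif : probability (measurableTypeR R) R := uniform_prob (@ltr01 R).

Lemma unif_lt (t : R) : 0 <= t <= 1 -> unif [set u | u < t] = t%:E.
Proof.
move=> /andP[t0 t1]; rewrite /unif /= /uniform_prob integral_uniform_pdf.
rewrite (_ : _ `&` _ = `[0, t[%classic); last first.
  apply/seteqP; split=> u /=; rewrite !in_itv /=; first by move=> [-> /andP[->]].
  by move=> /andP[-> ut]; rewrite ut (ltW (lt_le_trans ut t1)).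
rewrite (eq_integral (fun=> 1%:E)); last first.
  move=> u; rewrite inE/= in_itv/= => /andP[u0 ut].
  by rewrite /uniform_pdf u0 (ltW (lt_le_trans ut t1)) /= subr0 invr1.
rewrite integral_cst// mul1e /= lebesgue_measure_itv /= lte_fin.
case: ltP => [_|t0']; first by rewrite sube0.
by have -> : t = 0 by apply/eqP; rewrite eq_le t0 t0'.
Qed.

(** The law of [tau (b, u)] for a point [b] drawn from [omega] and an independent
    uniform variable [u]. *)
Lemma randomized_law_exists d d' (B : measurableType d) (Y : measurableType d')
    (omega : probability B R)
    (tau : B * measurableTypeR R -> Y) : measurable_fun setT tau ->
  exists P : probability Y R, forall U, measurable U ->
    P U = (\int[omega]_b unif [set u | U (tau (b, u))])%E.
Proof.
move=> mtau; pose X : {mfun (B * measurableTypeR R)%type >-> Y} :=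
  HB.pack tau (isMeasurableFun.Build _ _ _ _ tau mtau).
have m1 : (omega \x unif)%E setT = 1%E.
  by rewrite -setXTT product_measure1E//= !probability_setT mul1e.
have [Q QE] := probability_of m1.
exists (distribution Q X) => U mU.
rewrite -[LHS]/(Q (tau @^-1` U)) QE.
apply: eq_integral => b _ /=; congr (unif _).
by apply/seteqP; split=> u; rewrite /xsection /= inE.
Qed.
End MeasureTools.

(** * Conditional probabilities of sets as densities *)
Section ImageOn.
Context (R : realType) d d' (T : measurableType d) (Y : measurableType d')
  (m : {finite_measure set T -> \bar R}) (E : set T) (f : T -> Y).

(** The image under [f] of the trace of [m] on [E]; objects over [B] only come
    with maps that are measurable on their domain. *)
Definition image_on (mE : measurable E) (mf : measurable_fun E f)
  (U : set Y) : \bar R :=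
  m (E `&` f @^-1` U).

Hypotheses (mE : measurable E) (mf : measurable_fun E f).
Local Notation nu := (image_on mE mf).

Let nu0 : nu set0 = 0%E.
Proof. by rewrite /image_on preimage_set0 setI0 measure0. Qed.

Let nu_ge0 U : (0 <= nu U)%E.
Proof. exact: measure_ge0. Qed.

Let nu_additive : semi_sigma_additive nu.
Proof.
move=> F mF tF mUF; rewrite /image_on preimage_bigcup setI_bigcupr.
apply: measure_semi_sigma_additive.
- by move=> n; exact: mf.
- apply/trivIsetP => i j _ _ ij; rewrite setIACA setIid -preimage_setI.
  by move/trivIsetP : tF => /(_ i j I I ij) ->; rewrite preimage_set0 setI0.
- by rewrite -setI_bigcupr -preimage_bigcup; exact: mf.
Qed.

HB.instance Definition _ := isMeasure.Build _ _ _ nu nu0 nu_ge0 nu_additive.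

Let nu_fin : fin_num_fun nu.
Proof. by move=> U mU; apply: fin_num_measure; exact: mf. Qed.

HB.instance Definition _ := Measure_isFinite.Build _ _ _ nu nu_fin.

Lemma image_on_finite_measure : exists nu : {finite_measure set Y -> \bar R},
  forall U, nu U = m (E `&` f @^-1` U).
Proof. by exists nu. Qed.

End ImageOn.

Section Densities.
Context (R : realType) d (B : measurableType d) (omega : probability B R).

Definition is_density (X : meas_over B) (p : prob_over omega X) (S : set (ambient X))
  (f : B -> R) :=
  unit_fun f /\ forall T, measurable T ->
    p (S `&` (dom X `&` proj X @^-1` T)) = (\int[omega]_(b in T) (f b)%:E)%E.

Lemma measurable_proj_preimage (X : meas_over B) (T : set B) : measurable T ->
  measurable (dom X `&` proj X @^-1` T).
Proof. by move=> mT; apply: proj_measurable => //; exact: dom_measurable. Qed.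

Lemma int_unit_fin (f : B -> R) T : measurable T -> unit_fun f ->
  (\int[omega]_(b in T) (f b)%:E)%E \is a fin_num.
Proof.
move=> mT [mf f01]; rewrite ge0_fin_numE; last first.
  by apply: integral_ge0 => b _; rewrite lee_fin; case/andP: (f01 b).
apply: (@le_lt_trans _ _ (\int[omega]_(b in T) (cst 1 b))%E).
  apply: ge0_le_integral => //.
  - by move=> b _; rewrite lee_fin; case/andP: (f01 b).
  - by apply/measurable_EFinP; exact: measurable_funTS.
  - by move=> b _; rewrite lee_fin; case/andP: (f01 b).
by rewrite integral_cst// mul1e (le_lt_trans (probability_le1 _ mT))// ltry.
Qed.

Lemma density_proj (X : meas_over B) (p : prob_over omega X) A : measurable A ->
  is_density p (dom X `&` proj X @^-1` A) \1_A.
Proof.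
move=> mA; split; first exact: unit_fun_indic.
move=> T mT; rewrite setIACA setIid -preimage_setI
  (prob_over_proj p (measurableI _ _ mA mT)).
by rewrite integral_indic// setIC.
Qed.

Lemma density_setT (X : meas_over B) (p : prob_over omega X) : is_density p setT
    (fun=> 1).
Proof.
split=> [|T mT]; first exact: unit_fun1.
by rewrite setTI (prob_over_proj p mT) integral_cst// mul1e.
Qed.

Lemma density_preimage (X X' : meas_over B) (f : ambient X -> ambient X')
    (p : prob_over omega X) (p' : prob_over omega X') S h :
  is_over_map f -> is_pushforward f p p' -> measurable S -> is_density p' S h ->
  is_density p (dom X `&` f @^-1` S) h.
Proof.
move=> [mf fD fproj] pp' mS [uh hE]; split=> // T mT.
rewrite -hE// pp'; last by apply: measurableI => //; exact: measurable_proj_preimage.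
congr (p _); apply/seteqP; split=> [x [[Dx Sx] [_ Tx]]|x [Dx [Sx [_ Tx]]]].
  by split=> //; split=> //; split; [exact: fD|rewrite /= fproj].
by split=> //; split=> //; move: Tx; rewrite /= fproj.
Qed.

Lemma is_densityD (X : meas_over B) (p : prob_over omega X) S1 S2 f1 f2 :
  measurable S1 -> measurable S2 -> S1 `&` S2 = set0 ->
  (forall b, f1 b + f2 b <= 1) -> is_density p S1 f1 -> is_density p S2 f2 ->
  is_density p (S1 `|` S2) (fun b => f1 b + f2 b).
Proof.
move=> m1 m2 S120 f12 [u1 d1] [u2 d2]; split; first exact: unit_funD.
move=> T mT; rewrite setIUl; have mD := measurable_proj_preimage X mT.
have disj : S1 `&` (dom X `&` proj X @^-1` T) `&` (S2 `&` (dom X `&` proj X @^-1` T)) =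
  set0.
  by rewrite setIACA S120 set0I.
transitivity (p (S1 `&` (dom X `&` proj X @^-1` T)) +
  p (S2 `&` (dom X `&` proj X @^-1` T)))%E.
  by apply: measureU => //; exact: measurableI.
rewrite d1// d2// -ge0_integralD//; first by move=> b _; rewrite lee_fin;
  case/andP: (u1.2 b).
- by apply/measurable_EFinP/measurable_funTS; case: u1.
- by move=> b _; rewrite lee_fin; case/andP: (u2.2 b).
- by apply/measurable_EFinP/measurable_funTS; case: u2.
Qed.

(** On the set where [g < f] the difference [f - g] is positive, but its integral
    vanishes. *)
Lemma ae_le_of_integral (f g : B -> R) : measurable_fun setT f ->
    measurable_fun setT g ->
  (forall b, 0 <= f b) -> (forall b, 0 <= g b) ->
  (forall E, measurable E ->
    (\int[omega]_(b in E) (f b)%:E <= \int[omega]_(b in E) (g b)%:E)%E) ->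
  (forall E, measurable E -> (\int[omega]_(b in E) (g b)%:E)%E \is a fin_num) ->
  omega [set b | g b < f b] = 0%E.
Proof.
move=> mf mg f0 g0 fg gfin; set E := [set b | g b < f b].
have mE : measurable E by rewrite -[E]setTI; exact: (measurable_fun_ltr mg mf).
pose h b := `|f b - g b|.
have mh : measurable_fun setT h.
  by apply: measurableT_comp => //; exact: measurable_funB.
have hE : (\int[omega]_(b in E) (f b)%:E = \int[omega]_(b in E) (g b)%:E +
  \int[omega]_(b in E) (h b)%:E)%E.
  rewrite -ge0_integralD//.
  - apply: eq_integral => b /set_mem /= gf; rewrite -EFinD; congr (_%:E).
    by rewrite /h ger0_norm ?subr_ge0 ?(ltW gf)// addrC subrK.
  - by move=> b _; rewrite lee_fin.
  - by apply/measurable_EFinP; exact: measurable_funTS.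
  - by move=> b _; rewrite lee_fin normr_ge0.
  - by apply/measurable_EFinP; exact: measurable_funTS.
have h0 : (\int[omega]_(b in E) (h b)%:E = 0)%E.
  apply/eqP; rewrite eq_le; apply/andP; split; last by apply: integral_ge0 => b _;
    rewrite lee_fin normr_ge0.
  by have := fg _ mE; rewrite hE -[leRHS]adde0 leeD2lE //; exact: gfin.
have : (\int[omega]_(b in E) `|(f b - g b)%:E| = 0)%E by [].
have mfg : measurable_fun E (fun b => (f b - g b)%:E).
  by apply/measurable_EFinP; apply: measurable_funTS; exact: measurable_funB.
move=> /(ae_eq_integral_abs omega mE mfg) H.
apply/(negligibleP omega mE); apply: negligibleS H => b /= gf /(_ gf) /eqP.
by rewrite eqe subr_eq0 => /eqP e; move: gf; rewrite /E /= e ltxx.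
Qed.

(** The measure of the part of [S] over a variable set is dominated by [omega],
    and even bounded by it: hence its Radon-Nikodym derivative is at most [1]
    almost everywhere, and truncating it at [1] makes this true everywhere. *)
Lemma density_exists (X : meas_over B) (p : prob_over omega X) S : measurable S ->
  exists f, is_density p S f.
Proof.
move=> mS; have mD := @dom_measurable _ _ X.
have mSD : measurable (S `&` dom X) by exact: measurableI.
have mproj : measurable_fun (S `&` dom X) (proj X).
  by apply: measurable_funS (@proj_measurable _ _ X) => //; exact: subIsetr.
have [nu nuE'] := image_on_finite_measure p mSD mproj.
have nuE A : nu A = p (S `&` (dom X `&` proj X @^-1` A)) by rewrite nuE' setIA.
have nu_le A : measurable A -> (nu A <= omega A)%E.
  move=> mA; rewrite nuE -(prob_over_proj p mA).
  by apply: measureIr => //; exact: measurable_proj_preimage.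
have dom_nu : nu `<< omega.
  apply/null_content_dominatesP => A mA oA; apply/eqP; rewrite eq_le measure_ge0 andbT.
  by rewrite -oA nu_le.
have [F [F0 Ffin Fint FE]] := radon_nikodym_sigma_finite dom_nu.
pose f b := fine (F b).
have fF b : (f b)%:E = F b by rewrite fineK.
have f0 b : 0 <= f b by exact: fine_ge0.
have mf : measurable_fun setT f.
  by apply/measurable_EFinP; rewrite (_ : _ \o _ = F);
    [exact: measurable_int Fint|apply/funext => b; rewrite /= fF].
have f1 : omega [set b | 1 < f b] = 0%E.
  apply: ae_le_of_integral => // E mE; rewrite integral_cst// mul1e;
    last exact: fin_num_measure.
  by rewrite (eq_integral F) => [|b _]; [rewrite -FE// nu_le|exact: fF].
have mmin : measurable_fun setT (fun b => Num.min (f b) 1) by exact: measurable_minr.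
exists (fun b => Num.min (f b) 1); split.
  by split=> // b; rewrite ge_min lexx orbT le_min f0 ler01.
move=> T mT; rewrite -nuE FE//.
apply: ge0_ae_eq_integral => //.
- by apply: measurable_funTS; exact: measurable_int Fint.
- by apply/measurable_EFinP; exact: measurable_funTS.
- by move=> b _; rewrite lee_fin le_min f0 ler01.
have mlt : measurable [set b | 1 < f b] by rewrite -[X in measurable X]setTI;
  exact: (measurable_fun_ltr (measurable_cst _) mf).
move/(negligibleP omega mlt): f1; apply: negligibleS => b /= nb; rewrite ltNge;
  apply/negP => fb.
by apply: nb => _; rewrite -fF (min_idPl fb).
Qed.

Lemma density_le (X : meas_over B) (p : prob_over omega X) S S' f f' :
  measurable S -> measurable S' -> S `&` dom X `<=` S' -> is_density p S f ->
    is_density p S' f' ->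
  omega [set b | f' b < f b] = 0%E.
Proof.
move=> mS mS' SS' [[mf f01] fE] [[mf' f01'] fE'].
have f0 b : 0 <= f b by case/andP: (f01 b).
have f0' b : 0 <= f' b by case/andP: (f01' b).
apply: ae_le_of_integral => // [T mT|T mT]; last exact: int_unit_fin.
have mP := measurable_proj_preimage X mT.
rewrite -fE// -fE'//; apply: le_measure; rewrite ?inE; try exact: measurableI.
by move=> x [Sx [Dx Tx]]; split=> //; exact: SS'.
Qed.

End Densities.

(** * Products of standard Borel spaces with the natural numbers *)
Section Tagged.
Context (R : realType).

Definition tagged (P : Type) : Type := (P * nat)%type.
HB.instance Definition _ (P : choiceType) := Choice.copy (tagged P) (P * nat)%type.

Context (P : metricType R).
Implicit Types x y z : tagged P.

(** Copies of [P] with different tags are at distance at least [1], so balls of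
    small radius stay in one copy. *)
Definition tagged_dist x y : R := mdist x.1 y.1 + (x.2 != y.2)%:R.

Let dxx x : tagged_dist x x = 0.
Proof. by rewrite /tagged_dist mdistxx eqxx addr0. Qed.

Let d_pos x y : tagged_dist x y = 0 -> x = y.
Proof.
move: x y => [x i] [y j] /=; rewrite /tagged_dist /= => /eqP.
rewrite paddr_eq0 ?mdist_ge0 ?ler0n// => /andP[/eqP/mdist_positivity ->].
by rewrite pnatr_eq0 eqb0 negbK => /eqP ->.
Qed.

Let d_sym x y : tagged_dist x y = tagged_dist y x.
Proof. by rewrite /tagged_dist metric_sym eq_sym. Qed.

Let d_tri y x z : tagged_dist x z <= tagged_dist x y + tagged_dist y z.
Proof.
rewrite /tagged_dist addrACA lerD ?metric_triangle// -natrD ler_nat.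
by case: (eqVneq x.2 y.2) => [->|] //=; case: (eqVneq x.2 z.2).
Qed.

HB.instance Definition _ :=
  @isMetric.Build R (tagged P) tagged_dist dxx d_pos d_sym d_tri.

Lemma tagged_ball x (e : R) y : ball x e y =
    (mdist x.1 y.1 + (x.2 != y.2)%:R < e) :> Prop.
Proof. by rewrite ballEmdist. Qed.

(** A Cauchy filter eventually lives on one tag, and converges there since its
    first projection is Cauchy in [P]. *)
Lemma polish_tagged : polish P -> polish (tagged P : metricType R).
Proof.
move=> [cP [S cS dS]]; split.
  move=> F PF cF.
  have ball_fst x e : ball x e `<=` [set y | ball x.1 e y.1].
    by move=> y; rewrite tagged_ball ballEmdist /=; apply: le_lt_trans;
      rewrite lerDl ler0n.
  have cF1 : cauchy (fst @ F : set_system P).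
    apply: cauchy_exP => e e0; have /cauchyP/(_ e e0)[x Fx] := cF.
    by exists x.1; exact: (filterS (@ball_fst x e) Fx).
  have [x Fx] := cP _ _ cF1.
  have /cauchyP/(_ 1 ltr01)[c Fc] := cF.
  exists (x, c.2); apply/cvg_ballP => e e0.
  have Fxe : F [set y | ball x e y.1] by apply: (Fx (ball x e)); exact: nbhsx_ballx.
  near=> y.
  have yc : c.2 == y.2.
    have : ball c 1 y by near: y.
    rewrite tagged_ball; case: (c.2 == y.2) => //=.
    by rewrite ltNge lerDr mdist_ge0.
  rewrite tagged_ball /= yc addr0; have : ball x e y.1 by near: y.
  by rewrite ballEmdist.
exists (S `*` [set: nat] : set (tagged P)).
  by apply: countableX => //; exact: countableP.
move=> O [[x i] Ox] oO.
have /nbhs_ballP[e /= e0 eO] : nbhs ((x, i) : tagged P) O by exact: open_nbhs_nbhs.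
have [s [sb Ss]] : (ball x e)° `&` S !=set0.
  apply: dS; last exact: open_interior.
  by exists x; exact: nbhsx_ballx.
exists (s, i); split=> //; apply: eO; rewrite tagged_ball /= eqxx addr0.
by have := interior_subset sb; rewrite ballEmdist.
Unshelve. all: by end_near.
Qed.

Lemma open_tag i : open [set y : tagged P | y.2 = i].
Proof.
rewrite openE => y /= yi; apply/nbhs_ballP; exists 1 => //= w.
rewrite tagged_ball /= -yi; case: eqVneq => //= _.
by rewrite ltNge lerDr mdist_ge0.
Qed.

Lemma open_preimage_fst (U : set P) : open U -> open [set y : tagged P | U y.1].
Proof.
move=> oU; rewrite openE => y /= Uy.
have /nbhs_ballP[e /= e0 eU] : nbhs y.1 U by exact: open_nbhs_nbhs.
apply/nbhs_ballP; exists e => //= w; rewrite tagged_ball => yw; apply: eU.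
by rewrite ballEmdist /=; apply: le_lt_trans yw; rewrite lerDl ler0n.
Qed.

Lemma open_preimage_tag i (U : set (tagged P)) : open U -> open [set x : P | U (x, i)].
Proof.
move=> oU; rewrite openE => x /= Ux.
have /nbhs_ballP[e /= e0 eU] : nbhs ((x, i) : tagged P) U by exact: open_nbhs_nbhs.
apply/nbhs_ballP; exists e => //= w xw; apply: eU.
by move: xw; rewrite tagged_ball ballEmdist /= eqxx addr0.
Qed.

End Tagged.

Lemma sigma_preimage (X Y : Type) (G : set (set X)) (H : set (set Y)) (f : X -> Y) :
  (forall U, H U -> <<s G >> (f @^-1` U)) -> forall U, <<s H >> U ->
    <<s G >> (f @^-1` U).
Proof.
move=> HG; apply: smallest_sub => //; split=> [|A GA|F GF].
- by rewrite preimage_set0; exact: sigma_algebra0.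
- by rewrite setTD preimage_setC -setTD; exact: sigma_algebraCD.
- by rewrite preimage_bigcup; exact: sigma_algebra_bigcup.
Qed.

(** On either side of the isomorphism, a set is measurable if and only if its
    countably many sections are. *)
Lemma standard_borel_prod_nat (R : realType) d (B : measurableType d) :
  standard_borel R [set: B] -> standard_borel R [set: B * nat].
Proof.
move=> [P [pP [g [[_ ginj gsurj] gm]]]].
exists (tagged P : metricType R); split; first exact: polish_tagged.
exists (fun y => (g y.1, y.2)); split.
  split=> // [[x i] [y j] _ _ /= [e ->]|[b i] _].
    by congr (_, _); apply: ginj => //; exact: in_setT.
  by have [x _ <-] := gsurj b I; exists (x, i).
pose sec (A : set (B * nat)) i : set B := [set b | A (b, i)].
have secE A : A = \bigcup_i (sec A i `*` [set i]).
  by apply/seteqP; split=> [[b i] Ab|[b i] [j _ [/= + ->]]//]; exists i.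
move=> A _; split=> [mA|mA].
  rewrite (secE A) preimage_bigcup; apply: sigma_algebra_bigcup => i.
  have m1 : <<s open >> (g @^-1` sec A i).
    apply/gm => //.
    rewrite (_ : sec A i = ysection A i); first exact: measurable_ysection.
    by apply/seteqP; split=> b; rewrite /ysection /= inE.
  have m2 : <<s open >> [set y : tagged P | (g @^-1` sec A i) y.1].
    apply: (sigma_preimage (f := fst) _ m1) => U oU.
    by apply: sub_sigma_algebra; exact: open_preimage_fst.
  have m3 : <<s open >> [set y : tagged P | y.2 = i].
    by apply: sub_sigma_algebra; exact: open_tag.
  have [_ _ _ sI] := (sigma_algebraP (fun _ _ => @subsetT _ _)).1
    (smallest_sigma_algebra setT (@open (tagged P))).
  by apply: sI.
rewrite (secE A); apply: bigcupT_measurable => i; apply: measurableX => //.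
apply/gm => //.
apply: (sigma_preimage (f := fun x : P => (x, i) : tagged P) _ mA) => U oU.
by apply: sub_sigma_algebra; exact: open_preimage_tag.
Qed.

(** * Marking the points of a measurable set *)
Section Marking.
Context (R : realType) d (B : measurableType d) (omega : probability B R).

Definition marked : meas_over B :=
  @MeasOver _ B _ (B * nat)%type setT measurableT fst (measurable_funTS measurable_fst).

Let tau (w1 w2 : B -> R) (z : B * measurableTypeR R) : B * nat :=
  (z.1, if z.2 < w1 z.1 then 1 else if z.2 < w1 z.1 + w2 z.1 then 2 else 0).

(** Draw the base point [b] from [omega] and [u] uniformly in [0, 1]; the tag is
    [1] for [u < w1 b], [2] for [w1 b <= u < w1 b + w2 b], and [0] otherwise. *)
Lemma exists_marked (w1 w2 : B -> R) : unit_fun w1 -> unit_fun w2 ->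
  (forall b, w1 b + w2 b <= 1) ->
  exists p : prob_over omega marked, 
   [/\ is_density p [set z | z.2 = 1]%N w1, is_density p [set z | z.2 = 2]%N w2 &
     p [set z | (2 < z.2)%N] = 0%E].
Proof.
move=> u1 u2 u12.
have mfst : measurable_fun setT (fst : B * measurableTypeR R -> B) by [].
have mt : measurable_fun setT (tau w1 w2).
  apply: measurable_fun_pair => //=.
  have m1 : measurable_fun setT (fun z : B * measurableTypeR R => w1 z.1).
    by apply: measurableT_comp => //; case: u1.
  have m2 : measurable_fun setT (fun z : B * measurableTypeR R => w2 z.1).
    by apply: measurableT_comp => //; case: u2.
  have m0 : measurable_fun setT (fun z : B * measurableTypeR R => (z.2 : R)).
    exact: measurable_snd.
  apply: measurable_fun_ifT => //; first exact: measurable_fun_ltr.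
  apply: measurable_fun_ifT => //; apply: measurable_fun_ltr => //.
  exact: measurable_funD.
have [P PE] := randomized_law_exists omega mt.
have Pfst T : measurable T -> P (setT `&` fst @^-1` T) = omega T.
  move=> mT; rewrite setTI PE; last by rewrite -[X in measurable X]setTI;
    exact: measurable_fst.
  rewrite -[RHS]mul1e -integral_cst// [RHS]integral_mkcond.
  apply: eq_integral => b _; rewrite patchE /=; case: ifPn => bT.
    by rewrite (_ : [set _ | _] = setT) ?probability_setT//; apply/seteqP;
      split=> // u _; exact/set_mem.
  rewrite (_ : [set _ | _] = set0) ?measure0//; rewrite -subset0 => u /= bT'.
  by move: bT; rewrite mem_set.
have P1 : P setT = 1%E by exact: probability_setT.
exists (@ProbOver R d B omega marked P P1 Pfst).
have key (i : nat) (w : B -> R) T : measurable T -> 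
   (forall b, unif R [set u |
     (if u < w1 b then 1%N else if u < w1 b + w2 b then 2%N else 0%N) = i] =
     (w b)%:E) ->
   P ([set z | z.2 = i] `&` (setT `&` fst @^-1` T)) = (\int[omega]_(b in T) (w b)%:E)%E.
  move=> mT wE; rewrite setTI PE; last first.
    apply: measurableI; first exact: (measurable_preimage_snd [set i]).
    by rewrite -[X in measurable X]setTI; exact: measurable_fst.
  rewrite [RHS]integral_mkcond; apply: eq_integral => b _.
  rewrite patchE /=; case: ifPn => bT.
    rewrite -wE; congr (unif R _); apply/seteqP; split=> [u [] //|u /= ui]; split => //.
    exact: set_mem.
  rewrite (_ : [set _ | _] = set0) ?measure0//; rewrite -subset0 => u /= [_ bT'].
  by move: bT; rewrite mem_set.
have ult (t : R) : measurable [set u : measurableTypeR R | u < t].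
  rewrite (_ : [set _ | _] = `]-oo, t[%classic); first exact: measurable_itv.
  by apply/seteqP; split=> u /=; rewrite in_itv.
split.
- split=> // T mT; apply: key => // b; rewrite -unif_lt; last by case: u1.
  congr (unif R _); apply/seteqP; split=> u /=; last by move=> ->.
  by case: ifP => //; case: ifP.
- split=> // T mT; apply: key => // b.
  have [[_ /(_ b)/andP[w10 w11]] [_ /(_ b)/andP[w20 w21]]] := (u1, u2).
  rewrite (_ : [set _ | _] = [set u | u < w1 b + w2 b] `\` [set u | u < w1 b]).
    rewrite measureD//=; [|exact: ult..|]; last first.
      by rewrite (le_lt_trans (probability_le1 _ (ult _)))// ltry.
    rewrite (_ : _ `&` _ = [set u | u < w1 b]) ?unif_lt ?w10 ?w11 ?u12 ?addr_ge0//.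
      by rewrite -EFinB; congr (_%:E); lra.
    by apply/seteqP; split=> [u [] //|u /= uw]; split=> //;
      rewrite (lt_le_trans uw)// lerDl.
  apply/seteqP; split=> u /=.
    by case: ifP => // /negP ?; case: ifP.
  by move=> [-> /negP/negbTE ->].
- rewrite /= PE; last exact: (measurable_preimage_snd [set i | (2 < i)%N]).
  apply: integral0_eq => b _; rewrite (_ : [set _ | _] = set0) ?measure0//.
  by rewrite -subset0 => u /=; case: ifP => //; case: ifP.
Qed.

Definition mark (X : meas_over B) (S : set (ambient X)) (x : ambient X) : B * nat :=
  (proj X x, x \in S : nat).

Lemma is_over_map_mark (X : meas_over B) (S : set (ambient X)) : measurable S ->
  is_over_map (X' := marked) (mark S).
Proof.
move=> mS; split=> //; apply: measurable_fun_pair_on; first exact: proj_measurable.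
apply: (measurable_comp (F := setT) (f := nat_of_bool)) => //.
apply: (measurable_fun_bool true); rewrite (_ : _ @^-1` _ = S).
  by apply: measurableI => //; exact: dom_measurable.
by apply/seteqP; split=> x /=; [move=> /set_mem|move=> /mem_set].
Qed.

Definition concentrated (p : prob_over omega marked) := p [set z | (1 < z.2)%N] = 0%E.

(** A measure over [omega] without mass on the tags above [1] is determined by
    its trace on the tag [1]: the trace on the tag [0] is the complement with
    respect to [omega]. *)
Lemma is_pushforward_mark (X : meas_over B) (p : prob_over omega X) S f
    (m : prob_over omega marked) : measurable S ->
  is_density p S f -> is_density m [set z | z.2 = 1%N] f -> concentrated m ->
  is_pushforward (X' := marked) (mark S) p m.
Proof.
move=> mS [uf pf] [_ mf] m0 U mU.
have mgt1 : measurable [set z : B * nat | (1 < z.2)%N].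
  exact: (measurable_preimage_snd [set i | (1 < i)%N]).
pose U1 := ysection U 1%N; pose U0 := ysection U 0%N.
have mU1 : measurable U1 by exact: measurable_ysection.
have mU0 : measurable U0 by exact: measurable_ysection.
have split01 A : measurable A ->
  m A = (m (A `&` [set z | z.2 = 1%N]) + m (A `&` [set z | z.2 = 0%N]))%E.
  move=> mA; rewrite [LHS](measureDI m mA mgt1).
  rewrite [X in (_ + X)%E](_ : _ = 0%E) ?adde0; last first.
    by apply: subset_measure0 m0;
      [exact: (measurableI _ _ mA mgt1)|exact: mgt1|move=> z []].
  have mi i := measurableI _ _ mA (@measurable_preimage_snd _ B [set i]).
  rewrite -measureU; [|exact: mi|exact: mi|]; last first.
    by rewrite -subset0 => z [[_ /= ->] []].
  congr (m _); apply/seteqP; split=> -[b i] /=.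
    by move=> [Ab]; case: i Ab => [|[|i]] Ab // _; [right|left].
  by case=> -[Ab e]; rewrite e in Ab *.
have mfst : measurable (setT `&` fst @^-1` U0 : set (B * nat))
  by exact: (measurable_proj_preimage marked mU0).
have m1 : m (U `&` [set z | z.2 = 1%N]) = (\int[omega]_(b in U1) (f b)%:E)%E.
  rewrite -mf//; congr (m _); apply/seteqP.
  split=> -[c i] /= => [[Uc e]|[-> [_]]]; last by rewrite /U1 /ysection /= inE.
  by rewrite e in Uc *; split => //; split => //; rewrite /U1 /ysection /= inE.
have m00 : m (U `&` [set z | z.2 = 0%N]) =
  m ((setT `&` fst @^-1` U0) `&` [set z | z.2 = 0%N]).
  congr (m _); apply/seteqP; split=> -[c i] /= => [[Ub e]|[[_ Ub] e]];
    rewrite e in Ub *.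
    by split=> //; split=> //; rewrite /U0 /ysection /= inE.
  by move: Ub; rewrite /U0 /ysection /= inE.
have fin0 : (\int[omega]_(b in U0) (f b)%:E)%E \is a fin_num by exact: int_unit_fin.
have m0E : m (U `&` [set z | z.2 = 0%N]) =
  (omega U0 - \int[omega]_(b in U0) (f b)%:E)%E.
  rewrite m00 -(prob_over_proj m mU0) (split01 _ mfst) [X in (m X + _)%E]setIC.
  by rewrite mf// [X in (X - _)%E]addeC addeK.
have mA := @measurable_proj_preimage _ B X.
rewrite (split01 _ mU) m1 m0E.
rewrite (_ : dom X `&` _ =
  (S `&` (dom X `&` proj X @^-1` U1)) `|` ((dom X `&` proj X @^-1` U0) `\` S));
  last first.
  rewrite /mark /U1 /U0 /ysection; apply/seteqP;
    split=> [x [Dx /= Ux]|x [[Sx [Dx /=]]|[[Dx /=]]] ].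
  - have [/set_mem Sx|/negP nS] := boolP (x \in S).
      by left; split=> //; split=> //=; rewrite inE; move: Ux; rewrite mem_set.
    right; split; last by move=> Sx; apply: nS; exact: mem_set.
    by split=> //=; rewrite inE; move: Ux; rewrite memNset// => Sx; apply: nS;
      exact: mem_set.
  - by rewrite inE => Ux; split=> //=; rewrite mem_set.
  - by rewrite inE => Ux nS; split=> //=; rewrite memNset.
rewrite measureU; [|by apply: measurableI => //; exact: mA|by apply: measurableD => //;
  exact: mA|]; last first.
  by rewrite -subset0 => x [[Sx _] []].
congr (_ + _)%E; first exact/esym/pf.
transitivity (p (dom X `&` proj X @^-1` U0) - p ((dom X `&` proj X @^-1` U0) `&` S))%E;
  last first.
  apply/esym; apply: measureD => //; first exact: mA.
  by rewrite (le_lt_trans (probability_le1 _ _)) ?ltry//; exact: mA.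
by rewrite prob_over_proj// setIC pf.
Qed.
End Marking.

(** * Uniqueness for probability measures *)
Lemma setXUl T1 T2 (A1 A2 : set T1) (C : set T2) :
  (A1 `|` A2) `*` C = (A1 `*` C) `|` (A2 `*` C).
Proof.
apply/seteqP; split=> [[x y] [/= [?|?] ?]|[x y] [|] [/= ? ?]]; [by left|by right| |].
  by split=> //; left.
by split=> //; right.
Qed.

Lemma setXUr T1 T2 (A : set T1) (C1 C2 : set T2) :
  A `*` (C1 `|` C2) = (A `*` C1) `|` (A `*` C2).
Proof.
apply/seteqP; split=> [[x y] [/= ? [?|?]]|[x y] [|] [/= ? ?]]; [by left|by right| |].
  by split=> //; left.
by split=> //; right.
Qed.

Section NaturalFamily.
Context (R : realType) d (B : measurableType d) (sB : standard_borel R [set: B])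
  (omega : probability B R) (a : prob_family sB omega) (nat_a : prob_natural a).

Definition marked_borel : borel_over R B :=
  @BorelOver R d B (marked B) (standard_borel_prod_nat sB).

Let Z := marked_borel.

Lemma exists_marked1 (f : B -> R) : exists p : prob_over omega Z,
  unit_fun f -> is_density p [set z | z.2 = 1%N] f /\ concentrated p.
Proof.
have one (g : B -> R) : unit_fun g -> exists p : prob_over omega Z,
    is_density p [set z | z.2 = 1%N] g /\ concentrated p.
  move=> ug; have [|p [p1 [_ p2] p3]] := exists_marked omega ug (unit_fun0 _ _).
    by move=> b; rewrite addr0; case: ug => _ /(_ b)/andP[].
  exists p; split=> //; rewrite /concentrated.
  have mi := @measurable_preimage_snd _ B [set 2%N].
  have mgt := @measurable_preimage_snd _ B [set i | (2 < i)%N].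
  have p20 : p [set z | z.2 = 2%N] = 0%E.
    have := p2 setT measurableT; rewrite integral0 => <-; congr (p _).
    by apply/seteqP; split=> [z //|z []].
  rewrite (_ : [set _ | _] = [set z | z.2 = 2%N] `|` [set z | (2 < z.2)%N]); last first.
    apply/seteqP; split=> z /=; last by case=> [->|/ltnW].
    by rewrite leq_eqVlt => /orP[/eqP <-|]; [left|right].
  apply/eqP; rewrite eq_le measure_ge0 andbT.
  by apply: (le_trans (measureU2 p mi mgt));
    rewrite [X in (X + _)%E]p20 [X in (_ + X)%E]p3 adde0.
have [uf|nuf] := pselect (unit_fun f); first by have [p] := one f uf; exists p.
by have [p _] := one _ (unit_fun0 _ _); exists p.
Qed.

Let Pf := projT1 (choice exists_marked1).

Let PfP f : unit_fun f ->
    is_density (Pf f) [set z | z.2 = 1%N] f /\ concentrated (Pf f) :=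
  projT2 (choice exists_marked1) f.

Let E : set ((B * nat) * (B * nat)) := [set z | z.1.2 = 1%N /\ z.2.2 = 1%N].

Let mone : measurable [set z : B * nat | z.2 = 1%N].
Proof. exact: (measurable_preimage_snd [set 1%N]). Qed.

Let mE : measurable E.
Proof. exact: (measurableX mone mone). Qed.

Let Phi f g := fine (a (Pf f : prob_over omega Z) (Pf g : prob_over omega Z) E).

Let a_fin (X Y : borel_over R B) (p : prob_over omega X) (q : prob_over omega Y) S :
  measurable S -> a p q S \is a fin_num.
Proof. by move=> mS; exact: fin_num_measure. Qed.

(** The marking maps of [S] and [T] are maps over [B], and they send [p] and [q]
    to measures that depend on [f] and [g] alone. *)
Lemma natural_rectE (X Y : borel_over R B) (p : prob_over omega X)
    (q : prob_over omega Y) S T f g :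
  measurable S -> measurable T -> is_density p S f -> is_density q T g ->
  a p q (S `*` T) = (Phi f g)%:E.
Proof.
move=> mS mT pf qg.
have [Pf1 Pf2] := PfP pf.1; have [Pg1 Pg2] := PfP qg.1.
rewrite fineK; last exact:
  (a_fin (Pf f : prob_over omega Z) (Pf g : prob_over omega Z) mE).
have := nat_a (X' := Z) (Y' := Z) (is_over_map_mark mS) (is_over_map_mark mT)
  (is_pushforward_mark mS pf Pf1 Pf2) (is_pushforward_mark mT qg Pg1 Pg2) mE => ->.
rewrite -(probability_full (D := fibre_dom (X := X) (Y := Y))) => //.
- congr (a _ _ _); apply/seteqP; split=> -[x y] [Dxy] /=.
    by move=> [Sx Ty]; split=> //; rewrite /E /mark /= !mem_set.
  rewrite /E /mark /= => -[Sx Ty]; split=> //; split; apply: set_mem.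
    by move: Sx; case: (_ \in _).
  by move: Ty; case: (_ \in _).
- exact: (fibre_dom_measurable sB).
- exact: measurableX.
- exact: (prob_over_dom (a p q)).
Qed.

Let meas_fst (T : set B) : measurable T ->
    measurable (setT `&` fst @^-1` T : set (B * nat)).
Proof. exact: (@measurable_proj_preimage _ B (marked B)). Qed.

Let mtwo : measurable [set z : B * nat | z.2 = 2%N].
Proof. exact: (measurable_preimage_snd [set 2%N]). Qed.

Let dis12 : [set z : B * nat | z.2 = 1%N] `&` [set z | z.2 = 2%N] = set0.
Proof. by rewrite -subset0 => z [/= ->]. Qed.

(** Tags [1] and [2] realise [f1] and [f2] as conditional probabilities of
    disjoint sets for one and the same measure. *)
Let PhiDl f1 f2 g : unit_fun f1 -> unit_fun f2 -> unit_fun g ->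
  (forall b, f1 b + f2 b <= 1) -> Phi (fun b => f1 b + f2 b) g = Phi f1 g + Phi f2 g.
Proof.
move=> u1 u2 ug u12; have [p [p1 p2 _]] := exists_marked omega u1 u2 u12.
have [q1 _] := PfP ug; have p12 :=
  is_densityD (X := Z) (p := p) mone mtwo dis12 u12 p1 p2.
have r1 := @natural_rectE Z Z p _ _ _ _ _ mone mone p1 q1.
have r2 := @natural_rectE Z Z p _ _ _ _ _ mtwo mone p2 q1.
have r12 := @natural_rectE Z Z p _ _ _ _ _ (measurableU _ _ mone mtwo) mone p12 q1.
apply: EFin_inj; rewrite EFinD -r1 -r2 -r12 setXUl.
apply: measureU; [exact: measurableX|exact: measurableX|].
by rewrite -setXI dis12 set0X.
Qed.

Let PhiDr f g1 g2 : unit_fun f -> unit_fun g1 -> unit_fun g2 ->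
  (forall b, g1 b + g2 b <= 1) -> Phi f (fun b => g1 b + g2 b) = Phi f g1 + Phi f g2.
Proof.
move=> uf u1 u2 u12; have [q [q1 q2 _]] := exists_marked omega u1 u2 u12.
have [p1 _] := PfP uf; have q12 :=
  is_densityD (X := Z) (p := q) mone mtwo dis12 u12 q1 q2.
have r1 := @natural_rectE Z Z _ q _ _ _ _ mone mone p1 q1.
have r2 := @natural_rectE Z Z _ q _ _ _ _ mone mtwo p1 q2.
have r12 := @natural_rectE Z Z _ q _ _ _ _ mone (measurableU _ _ mone mtwo) p1 q12.
apply: EFin_inj; rewrite EFinD -r1 -r2 -r12 setXUr.
apply: measureU; [exact: measurableX|exact: measurableX|].
by rewrite -setXI dis12 setX0.
Qed.

Let Phi_ge0 f g : 0 <= Phi f g. Proof. exact: fine_ge0. Qed.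

Let full_fibre (p q : prob_over omega Z) S : measurable S ->
  a p q (fibre_dom (X := Z) (Y := Z) `&` S) = a p q S.
Proof.
move=> mS; apply: probability_full => //; first exact: (fibre_dom_measurable sB).
exact: (prob_over_dom (a p q)).
Qed.

(** On the fibre product both components have the same base point, so requiring
    it to lie in [A] is the same condition on the first and on the second one. *)
Let Phi_indic A g : measurable A -> unit_fun g ->
  Phi \1_A g = Phi (fun=> 1) (fun b => \1_A b * g b).
Proof.
move=> mA ug; have [[_ q1] _] := PfP ug; set q := Pf g in q1 *.
pose p := Pf (fun=> 1).
have q1A : is_density q ([set z | z.2 = 1%N] `&` (setT `&` fst @^-1` A))
  (fun b => \1_A b * g b).
  split=> [|T mT]; first exact: (unit_funM (unit_fun_indic R mA) ug).
  rewrite -setIA setIACA setIid -preimage_setI (q1 _ (measurableI _ _ mA mT)).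
  rewrite setIC [LHS]integral_mkcondr; apply: eq_integral => b _.
  by rewrite patchE indicE; case: ifP; rewrite ?mul1r ?mul0r.
have p1 := density_setT p.
have r1 := @natural_rectE Z Z p q _ _ _ _ (meas_fst mA) mone (density_proj p mA)
  (conj ug q1).
have r2 := @natural_rectE Z Z p q _ _ _ _ measurableT
  (measurableI _ _ mone (meas_fst mA)) p1 q1A.
apply: EFin_inj; rewrite -r1 -r2 -full_fibre;
  last exact: (measurableX (meas_fst mA) mone).
rewrite -[RHS]full_fibre;
  last exact: (measurableX measurableT (measurableI _ _ mone (meas_fst mA))).
congr (a _ _ _); apply/seteqP; split=> -[[b i] [b' j]] /=.
  by move=> [[_ _ /= e] [[_ /= Ab] j1]]; split=> //; split=> //; split=> //;
    split=> //=; rewrite -e.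
by move=> [[_ _ /= e] [_ [/= j1 [_ Ab]]]]; split=> //; split=> //; split=> //=;
  rewrite e.
Qed.

(** The mass of the part of the fibre product over [A] is prescribed. *)
Let Phi_indic1 A : measurable A -> Phi (fun=> 1) \1_A = fine (omega A).
Proof.
move=> mA; pose p := Pf (fun=> 1).
have p1 := density_setT p.
have r := @natural_rectE Z Z p p _ _ _ _ measurableT (meas_fst mA) p1
  (density_proj p mA).
apply: EFin_inj; rewrite -r fineK; last exact: fin_num_measure.
rewrite -(prob_over_proj (a p p) mA) -full_fibre; last by apply: measurableX => //;
  exact: meas_fst.
congr (a _ _ _); apply/seteqP; split=> -[[b i] [b' j]] /=.
  by move=> [[_ _ /= e] [_ [_ /= Ab]]]; split=> //=; rewrite e.
by move=> [[_ _ /= e] /= Ab]; split=> //; split=> //; split=> //=; rewrite -e.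
Qed.

Let int_additive (h : B -> R) : unit_fun h ->
  additive_functional (fun f => fine (\int[omega]_b (f b * h b)%:E)%E).
Proof.
move=> uh; have uM f (uf : unit_fun f) := unit_funM uf uh.
split=> [f uf|f g uf ug fg].
  by apply: fine_ge0; apply: integral_ge0 => b _; rewrite lee_fin;
    case/andP: ((uM f uf).2 b).
rewrite -fineD; [|exact: int_unit_fin (uM f uf)|exact: int_unit_fin (uM g ug)].
congr fine; rewrite -ge0_integralD//.
- by apply: eq_integral => b _; rewrite mulrDl.
- by move=> b _; rewrite lee_fin; case/andP: ((uM f uf).2 b).
- by apply/measurable_EFinP; case: (uM f uf).
- by move=> b _; rewrite lee_fin; case/andP: ((uM g ug).2 b).
- by apply/measurable_EFinP; case: (uM g ug).
Qed.

(** Agreement on indicators is used first in the second argument, with the first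
    one equal to [1], then in the first argument with [g] fixed. *)
Let PhiE f g : unit_fun f -> unit_fun g ->
    Phi f g = fine (\int[omega]_b (f b * g b)%:E)%E.
Proof.
have Phi1 h : unit_fun h -> Phi (fun=> 1) h = fine (\int[omega]_b (h b * 1)%:E)%E.
  apply: (additive_functional_unique _ (int_additive (unit_fun1 _ _))).
    split=> [k _|k1 k2 u1 u2 u12]; [exact: Phi_ge0|].
    exact: (PhiDr (unit_fun1 _ _) u1 u2 u12).
  move=> A mA; rewrite Phi_indic1//.
  by under eq_integral do rewrite mulr1; rewrite integral_indic// setIT.
move=> uf ug; move: f uf.
apply: (additive_functional_unique _ (int_additive ug)).
  by split=> [f _|f1 f2 u1 u2 u12]; [exact: Phi_ge0|exact: PhiDl].
move=> A mA; rewrite Phi_indic// Phi1; last exact: (unit_funM (unit_fun_indic R mA) ug).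
by under eq_integral do rewrite mulr1.
Qed.

Theorem natural_rectangle (X Y : borel_over R B) (p : prob_over omega X)
    (q : prob_over omega Y)
    S T f g : measurable S -> measurable T -> is_density p S f -> is_density q T g ->
  a p q (S `*` T) = (\int[omega]_b (f b * g b)%:E)%E.
Proof.
move=> mS mT pf qg; rewrite (natural_rectE mS mT pf qg) PhiE;
  [|exact: pf.1|exact: qg.1].
by rewrite fineK// int_unit_fin//; exact: (unit_funM pf.1 qg.1).
Qed.

End NaturalFamily.

(** * Ternary codes of sequences of bits *)
Section Ternary.
Context (R : realType).
Implicit Types (beta : nat -> bool) (t : R).

Let psum beta n : R := \sum_(k < n) ((beta k)%:R * 2) / 3 ^+ k.+1.

Let psum_le beta n : psum beta n <= 1 - 3 ^- n.
Proof.
elim: n => [|n IH]; first by rewrite /psum big_ord0 expr0 invr1 subrr.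
rewrite /psum big_ord_recr /=; apply: (le_trans (lerD IH (lexx _))).
have e0 : 0 < 3 ^- n :> R by rewrite invr_gt0 exprn_gt0.
rewrite exprS invfM; case: (beta n) => /=; lra.
Qed.

Let psum_nd beta : nondecreasing_seq (psum beta).
Proof.
apply/nondecreasing_seqP => n; rewrite /psum big_ord_recr /= lerDl.
by rewrite !mulr_ge0// invr_ge0 exprn_ge0.
Qed.

Let psum_cvg beta : cvgn (psum beta).
Proof.
apply: nondecreasing_is_cvgn => //; exists 1 => _ [n _ <-].
by apply: (le_trans (psum_le _ _)); rewrite gerBl invr_ge0 exprn_ge0.
Qed.

(** Only the ternary digits [0] and [2] occur, hence the first bit can be read
    off: the number is at most [1/3] or at least [2/3]. *)
Definition ternary beta : R := limn (psum beta).

Lemma ternary_ge0 beta : 0 <= ternary beta.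
Proof.
by have := nondecreasing_cvgn_le (psum_nd beta) (@psum_cvg beta) 0;
  rewrite /psum big_ord0.
Qed.

Lemma ternary_le1 beta : ternary beta <= 1.
Proof.
apply: limr_le; first exact: psum_cvg.
by near=> n; apply: (le_trans (psum_le _ _)); rewrite gerBl invr_ge0 exprn_ge0.
Unshelve. all: by end_near. Qed.

Let ternary_shift beta : ternary beta = ((beta 0%N)%:R * 2 + ternary (beta \o S)) / 3.
Proof.
apply/cvg_lim => //; rewrite -cvg_shiftS.
have -> : [sequence psum beta n.+1]_n =
  (fun n => ((beta 0%N)%:R * 2 + psum (beta \o S) n) / 3).
  apply/funext => n; rewrite /psum /= big_ord_recl /= expr1 mulrDl; congr (_ + _).
  rewrite mulr_suml; apply: eq_bigr => k _.
  by rewrite /bump /= add1n [in LHS]exprSr invfM mulrA.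
apply: cvgMl; apply: cvgD; first exact: cvg_cst.
exact: psum_cvg.
Qed.

(** The number obtained by deleting the first digit. *)
Definition ternary_rest t : R := 3 * t - (2^-1 <= t)%R%:R * 2.

Definition ternary_digit (k : nat) : set R := [set t | 2^-1 <= iter k ternary_rest t].

Lemma ternary_digitE beta k : ternary_digit k (ternary beta) <-> beta k.
Proof.
have ge_half b : (2^-1 <= ternary b) = b 0%N.
  rewrite ternary_shift; have := ternary_ge0 (b \o S); have := ternary_le1 (b \o S).
  by case: (b 0%N) => /= ? ?; [|apply/negbTE; rewrite -ltNge]; lra.
have rest b : ternary_rest (ternary b) = ternary (b \o S).
  by rewrite /ternary_rest ge_half [in LHS]ternary_shift mulrC divfK// addrC addKr.
rewrite /ternary_digit /=; suff ->
    : iter k ternary_rest (ternary beta) = ternary (fun n => beta (n + k)%N).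
  by rewrite ge_half.
elim: k => [|k IH] /=; first by congr ternary; apply/funext => n; rewrite addn0.
by rewrite IH rest; congr ternary; apply/funext => n /=; rewrite addSnnS.
Qed.

Lemma measurable_ternary_digit k : measurable (ternary_digit k).
Proof.
have mr : measurable_fun setT ternary_rest.
  apply: measurable_funB; first exact: measurable_funM.
  apply: measurable_funM => //.
  rewrite (_ : (fun _ => _) = (\1_[set t | 2^-1 <= t] : R -> R)); last first.
    by apply/funext => t; rewrite indicE; congr (nat_of_bool _)%:R;
      apply/idP/idP => [?|/set_mem//]; apply/mem_set.
  apply: measurable_indic.
  rewrite (_ : [set _ | _] = `[2^-1, +oo[%classic); first exact: measurable_itv.
  by apply/seteqP; split=> t /=; rewrite in_itv /= andbT.
have mi : measurable_fun setT (iter k ternary_rest).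
  by elim: k => [|k IH] /=; [exact: measurable_id|exact: measurableT_comp].
rewrite -[X in measurable X]setTI; exact: (measurable_fun_ler (measurable_cst _) mi).
Qed.

Lemma measurable_ternary d (T : measurableType d) (E : nat -> set T) :
  (forall k, measurable (E k)) ->
    measurable_fun setT (fun x => ternary (fun k => x \in E k)).
Proof.
move=> mE; apply: (measurable_fun_cvg (h := fun n x => psum (fun k => x \in E k) n)).
  move=> n; apply: measurable_sum => k.
  apply: measurable_funM => //; apply: measurable_funM => //.
  by apply: (measurable_indic (U := E k)).
by move=> x _; exact: psum_cvg.
Qed.
End Ternary.

(** * Standard Borel spaces as measurable retracts of the line *)
Lemma polish_cvg (R : realType) (P : metricType R) (y : nat -> P) : polish P ->
  (forall m : nat, exists N, forall n n', (N <= n)%N -> (N <= n')%N ->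
    mdist (y n) (y n') < m.+1%:R^-1) ->
  exists x : P, y @ \oo --> x.
Proof.
move=> [cP _] cy; apply: cP; apply: cauchy_exP => e e0.
have [m _ /(_ m (leqnn m)) /= me] := near_infty_natSinv_lt (PosNum e0).
have [N yN] := cy m; exists (y N); exists N => //= n Nn.
by rewrite ballEmdist /=; apply: lt_trans me; exact: yN.
Qed.

Lemma metric_cvgP (R : realType) (P : metricType R) (y : nat -> P) x :
  (y @ \oo --> x) <-> forall m : nat, exists N, forall n, (N <= n)%N ->
    mdist x (y n) < m.+1%:R^-1.
Proof.
split=> [yx m|H].
  have m0 : 0 < m.+1%:R^-1 :> R by rewrite invr_gt0.
  have [N _ yN] := yx (ball x m.+1%:R^-1) (nbhsx_ballx x _ m0).
  by exists N => n Nn; have := yN n Nn; rewrite /= ballEmdist.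
apply/cvg_ballP => e e0.
have [m _ /(_ m (leqnn m)) /= me] := near_infty_natSinv_lt (PosNum e0).
have [N yN] := H m; exists N => //= n Nn.
by rewrite ballEmdist /=; apply: lt_trans me; exact: yN.
Qed.

(** In this section [dig n i t] means that the point coded by [t] lies in the
    ball of centre [s i] and radius [1 / n.+1].  Not every [t] is a code. *)
Section Retract.
Context (R : realType) (P : metricType R) (pP : polish P) (s : nat -> P).
Hypothesis s_dense : forall x (e : R), 0 < e -> exists i, mdist (s i) x < e.
Context d (T : measurableType d) (dig : nat -> nat -> set T)
  (mdig : forall n i, measurable (dig n i)).

(** The index of some ball of radius [1 / n.+1] listed by [t]; the least one, so
    as to depend measurably on [t].  The default value [0] is for those [t] that
    list no such ball. *)
Definition first_index (n : nat) (t : T) : nat :=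
  if pselect (exists i, `[< dig n i t >]) is left h then ex_minn h else 0%N.

Let e (n : nat) : R := n.+1%:R^-1.

Lemma first_indexP n t : (exists i, dig n i t) -> dig n (first_index n t) t.
Proof.
move=> [i di]; rewrite /first_index; case: pselect => [h|[]].
  by case: ex_minnP => m /asboolP.
by exists i; apply/asboolP.
Qed.

Lemma measurable_first_index n (V : set nat) : measurable [set t | V (first_index n t)].
Proof.
have m1 j : measurable [set t | first_index n t = j].
  pose A := dig n j `&` \bigcap_i (if (i < j)%N then ~` dig n i else setT).
  pose N := \bigcap_i ~` dig n i.
  rewrite (_ : [set _ | _] = A `|` (if j == 0%N then N else set0)); last first.
    apply/seteqP; split=> t /=.
      rewrite /first_index; case: pselect => [h|h].
        case: ex_minnP => m /asboolP dm mmin mj; left; rewrite /A -mj; split=> // i _.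
        case: ifPn => // im /= di.
        by have := mmin i (asboolT di); rewrite leqNgt im.
      by move=> <-; right => /= i _ /= di; apply: h; exists i; exact/asboolP.
    move=> [[dj jmin]|].
      rewrite /first_index; case: pselect => [h|[]]; last by exists j; exact/asboolP.
      case: ex_minnP => m /asboolP dm mmin; apply/eqP; rewrite eqn_leq; apply/andP;
        split.
        by apply: mmin; exact/asboolP.
      by rewrite leqNgt; apply/negP => mj; have := jmin m I; rewrite mj; apply.
    case: eqVneq => // -> Nt; rewrite /first_index; case: pselect => // h; exfalso.
    by case: h => i /asboolP; exact: Nt.
  apply: measurableU.
    apply: measurableI => //; apply: bigcapT_measurable => i.
    by case: ifP => // _; exact: measurableC.
  case: ifP => // _; apply: bigcapT_measurable => i; exact: measurableC.
rewrite (_ : [set _ | _] = \bigcup_(j in V) [set t | first_index n t = j]).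
  exact: bigcup_measurable.
by apply/seteqP; split=> t /= => [Vt|[j Vj ->] //]; exists (first_index n t).
Qed.

Let y t n := s (first_index n t).

(** The limit of the centres selected by [t], and [s 0] if there is none. *)
Definition decode t : P := xget (s 0%N) [set x | y t @ \oo --> x].

Let conv : set T := \bigcap_m \bigcup_N \bigcap_n \bigcap_n'
  [set t | mdist (y t (N + n)%N) (y t (N + n')%N) < e m].

Let convP t : conv t <-> exists x : P, y t @ \oo --> x.
Proof.
split=> [ct|[x /metric_cvgP yx] m _].
  apply: polish_cvg => // m; have [N _ cN] := ct m I; exists N => n n' Nn Nn'.
  by have := cN (n - N)%N I (n' - N)%N I; rewrite /= !subnKC.
have [N yN] := yx (m.*2.+1)%N; exists N => // n _ n' _ /=.
have e2 : (m.*2.+2)%:R^-1 + (m.*2.+2)%:R^-1 = e m :> R.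
  rewrite /e -doubleS -mul2n natrM invfM -mulrDl -[RHS]mul1r; congr (_ * _); lra.
apply: (le_lt_trans (metric_triangle _ x _)); rewrite -e2 ltrD//.
  by rewrite metric_sym yN// leq_addr.
by rewrite yN// leq_addr.
Qed.

Let measurable_conv : measurable conv.
Proof.
apply: bigcapT_measurable => m; apply: bigcupT_measurable => N.
apply: bigcapT_measurable => n; apply: bigcapT_measurable => n'.
rewrite (_ : [set _ | _] = \bigcup_j ([set t | first_index (N + n)%N t = j] `&`
   [set t | [set j' | mdist (s j) (s j') < e m] (first_index (N + n')%N t)])).
  apply: bigcupT_measurable => j; apply: measurableI.
    exact: (measurable_first_index (N + n)%N [set j]).
  exact: measurable_first_index.
apply/seteqP; split=> t /=; first by move=> ?; exists (first_index (N + n)%N t).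
by move=> [j _ [<-]].
Qed.

(** Whether the limit lies in an open set [U] can be told from the approximations:
    eventually their balls of some fixed radius must be contained in [U].  As the
    approximations take countably many values, each a measurable function of [t],
    this is a countable combination of measurable conditions. *)
Lemma decode_measurable (U : set P) : <<s open >> U -> measurable (decode @^-1` U).
Proof.
move: U; apply: smallest_sub.
  split=> [|A mA|F mF]; first by rewrite preimage_set0.
    by rewrite setTD preimage_setC; exact: measurableC.
  by rewrite preimage_bigcup; exact: bigcupT_measurable.
move=> U oU.
pose In := \bigcup_m \bigcup_N \bigcap_n [set t | ball (y t (N + n)%N) (e m) `<=` U].
have mIn : measurable In.
  apply: bigcupT_measurable => m; apply: bigcupT_measurable => N;
    apply: bigcapT_measurable => n.
  exact: (measurable_first_index (N + n)%N [set j | ball (s j) (e m) `<=` U]).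
have convE t : conv t -> y t @ \oo --> decode t.
  move=> /convP[x yx]; exact:
    (xgetPex (s 0%N) (ex_intro (fun x : P => y t @ \oo --> x) x yx)).
have nconvE t : ~ conv t -> decode t = s 0%N.
  by move=> nc; apply: xgetPN => x yx; apply: nc; apply/convP; exists x.
rewrite (_ : _ @^-1` _ = (conv `&` In) `|`
  (if `[< U (s 0%N) >] then ~` conv else set0)).
  apply: measurableU; first exact: measurableI.
  by case: ifP => // _; exact: measurableC.
apply/seteqP; split=> t /=.
  have [ct Ut|nc] := pselect (conv t); last first.
    by rewrite nconvE// => /asboolP ->; right.
  left; split=> //; have yt := convE _ ct.
  have [m mU] : exists m, ball (decode t) (e m) `<=` U.
    have /nbhs_ballP[r /= r0 rU] : nbhs (decode t) U by exact: open_nbhs_nbhs.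
    have [m _ /(_ m (leqnn m)) /= me] := near_infty_natSinv_lt (PosNum r0).
    by exists m => z; rewrite ballEmdist /= => zm; apply: rU; rewrite ballEmdist /=;
      exact: lt_trans me.
  have e2 : (m.*2.+2)%:R^-1 + (m.*2.+2)%:R^-1 = e m :> R.
    rewrite /e -doubleS -mul2n natrM invfM -mulrDl -[RHS]mul1r; congr (_ * _); lra.
  have /metric_cvgP/(_ (m.*2.+1)%N)[N yN] := yt.
  exists (m.*2.+1)%N => //; exists N => // n _ /= z; rewrite ballEmdist /= => zm.
  apply: mU; rewrite ballEmdist /=;
    apply: (le_lt_trans (metric_triangle _ (y t (N + n)%N) _)).
  by rewrite -e2 ltrD// yN// leq_addr.
move=> [[ct [m _ [N _ NU]]]|]; last first.
  by case: asboolP => // Us nc; rewrite nconvE.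
have /metric_cvgP/(_ m)[N' yN] := convE _ ct.
apply: (NU N' I); rewrite ballEmdist /= metric_sym.
by apply: yN; rewrite leq_addl.
Qed.

(** The selected centres are within [1 / n.+1] of [x]. *)
Lemma decodeE t x : (forall n i, dig n i t <-> mdist (s i) x < e n) -> decode t = x.
Proof.
move=> digE.
have yx : y t @ \oo --> x.
  apply/metric_cvgP => m; exists m => n mn; rewrite metric_sym.
  have : mdist (y t n) x < e n.
    apply/digE; apply: first_indexP.
    have [|i ix] := @s_dense x (e n); first by rewrite invr_gt0.
    by exists i; apply/digE.
  by move=> /lt_le_trans; apply; rewrite lef_pV2 ?posrE// ler_nat.
apply: xget_unique => // x' yx'.
by apply: (cvg_unique _ yx' yx); exact: metric_hausdorff.
Qed.

End Retract.

Lemma metric_ball_open (R : realType) (P : metricType R) (x : P) (r : R) : open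
    (ball x r).
Proof.
rewrite openE => w; rewrite ballEmdist /= => xw.
have e0 : 0 < r - mdist x w by rewrite subr_gt0.
apply: filterS (nbhsx_ballx w _ e0) => z; rewrite !ballEmdist /= => wz.
by apply: (le_lt_trans (metric_triangle x w z)); rewrite addrC -ltrBrDr.
Qed.

(** The code of a point collects its memberships in countably many balls; the
    decoding map is defined on the whole line, and only has to invert the code
    from the left. *)
Theorem borel_retract (R : realType) d (T : measurableType d) (D : set T) :
  standard_borel R D -> D !=set0 ->
  exists (c : T -> R) (r : R -> T), [/\ measurable_fun setT c, measurable_fun setT r,
    forall x, 0 <= c x <= 1, forall t, D (r t) & forall x, D x -> r (c x) = x].
Proof.
move=> [P [pP [g [[gD ginj gsurj] gm]]]] [x0 Dx0].
have gD' u : D (g u) by exact: gD.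
have injg u v : g u = g v -> u = v by move=> guv; apply: ginj => //; exact: in_setT.
have [_ [S cS dS]] := pP.
have [u0 _ _] := gsurj _ Dx0.
have dense_ex x (r : R) : 0 < r -> exists2 u, S u & mdist u x < r.
  move=> r0; have [u [xu Su]] : ball x r `&` S !=set0.
    by apply: dS; [exists x; exact: ballxx|exact: metric_ball_open].
  by exists u => //; move: xu; rewrite ballEmdist metric_sym.
have [s sS] : exists s : nat -> P, S `<=` range s.
  have /countable_injP[f finj] := cS.
  exists (fun n => xget u0 [set u | S u /\ f u = n]) => u Su; exists (f u) => //.
  apply: xget_unique => // v [Sv fvu]; apply: finj => //; exact: mem_set.
pose E (k : nat) : set T :=
  if unpickle k is Some (n, i) then g @` ball (s i) (n.+1%:R^-1 : R) else set0.
have mE k : measurable (E k).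
  rewrite /E; case: unpickle => // -[n i].
  apply/gm; first by move=> _ [u _ <-].
  rewrite (_ : _ @^-1` _ = ball (s i) (n.+1%:R^-1 : R)).
    by apply: sub_sigma_algebra; exact: metric_ball_open.
  by apply/seteqP; split=> [u [v vB /injg <-]//|u uB]; exists u.
pose c (x : T) : R := ternary R (fun k => x \in E k).
pose dig (n i : nat) : set R := ternary_digit (pickle (n, i)).
have digP n i u : dig n i (c (g u)) <-> ball (s i) (n.+1%:R^-1 : R) u.
  rewrite /dig /c; split=> [/ternary_digitE|Bu].
    rewrite /E pickleK => /set_mem[v vB /injg <-] //.
  by apply/ternary_digitE/mem_set; rewrite /E pickleK; exists u.
have mdig n i : measurable (dig n i) by exact: measurable_ternary_digit.
exists c, (g \o decode s dig); split => //.
- exact: measurable_ternary.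
- move=> _ A mA; rewrite setTI comp_preimage.
  rewrite (_ : g @^-1` A = g @^-1` (D `&` A)).
    apply: decode_measurable => //; apply/gm; first by move=> x [].
    apply: measurableI => //; apply/gm => //.
    by rewrite (_ : _ @^-1` _ = setT);
      [apply: sub_sigma_algebra; exact: openT|apply/seteqP; split].
  by apply/seteqP; split=> [u Au|u []].
- by move=> x; rewrite ternary_ge0 ternary_le1.
- by move=> t /=; exact: gD'.
- move=> x /gsurj[u _ <-] /=; congr g; apply: decodeE => // [v r r0|n i].
    have [w /sS[i _ <-] wv] := dense_ex v r r0; by exists i.
  by split => [/digP|mu]; [|apply/digP]; rewrite ballEmdist.
Qed.

(** * Regular conditional probabilities *)
Section RandomKernel.
Context (R : realType) d d' (B : measurableType d) (Y : measurableType d')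
  (tau : B * measurableTypeR R -> Y).

Let slice (mtau : measurable_fun setT tau) b : measurable_fun setT
    (fun u => tau (b, u)).
Proof. by apply: measurableT_comp. Qed.

Definition random_kernel (mtau : measurable_fun setT tau) (b : B) : {measure set Y ->
  \bar R} :=
  image_on (unif R) measurableT (slice mtau b).

Hypothesis mtau : measurable_fun setT tau.

Let random_kernelE b U : random_kernel mtau b U = unif R [set u | U (tau (b, u))].
Proof. by rewrite /random_kernel /= /image_on setTI. Qed.

Let measurable_random_kernel U : measurable U ->
  measurable_fun setT (random_kernel mtau ^~ U).
Proof.
move=> mU; have mpre : measurable (tau @^-1` U) by rewrite -[X in measurable X]setTI;
  exact: mtau.
rewrite (_ : random_kernel mtau ^~ U = unif R \o xsection (tau @^-1` U));
  first exact: measurable_fun_xsection.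
apply/funext => b; rewrite random_kernelE /=; congr (unif R _).
by apply/seteqP; split=> u; rewrite /xsection /= inE.
Qed.

HB.instance Definition _ :=
  isKernel.Build _ _ _ _ _ (random_kernel mtau) measurable_random_kernel.

Let random_kernel1 b : random_kernel mtau b setT = 1%E.
Proof. by rewrite random_kernelE -(probability_setT (unif R)); congr (unif R _);
  apply/seteqP; split. Qed.

HB.instance Definition _ :=
  Kernel_isProbability.Build _ _ _ _ _ (random_kernel mtau) random_kernel1.

Lemma random_kernel_exists : exists k : R.-pker B ~> Y, forall b U,
  k b U = unif R [set u | U (tau (b, u))].
Proof. by exists (random_kernel mtau) => b U; exact: random_kernelE. Qed.
End RandomKernel.

Section Disintegration.
Context (R : realType) d (B : measurableType d) (omega : probability B R)
  (X : meas_over B) (p : prob_over omega X) (c : ambient X -> R).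
Hypotheses (mc : measurable_fun setT c) (c01 : forall x, 0 <= c x <= 1).

Let below (t : R) : set (ambient X) := [set x | c x < t].

Let measurable_below t : measurable (below t).
Proof. by rewrite -[below t]setTI;
  exact: (measurable_fun_ltr mc (measurable_cst _)). Qed.

Let F : rat -> B -> R := fun q =>
    projT1 (cid (density_exists p (measurable_below (ratr q)))).

Let FP q : is_density p (below (ratr q)) (F q) :=
    projT2 (cid (density_exists p (measurable_below (ratr q)))).

(** The generalised inverse of the conditional distribution function of [c].
    The extra element [2] lies above all values of [c] and keeps the infimum
    away from the empty set. *)
Definition quantile (z : B * measurableTypeR R) : R :=
  inf ([set 2] `|` [set ratr q | q in [set q : rat | 0 <= q /\ z.2 < F q z.1]]).

Lemma quantile_lt z t : t <= 2 ->
    quantile z < t <-> exists q : rat, [/\ 0 <= q, ratr q < t & z.2 < F q z.1].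
Proof.
rewrite /quantile => t2; set A := (X in inf X).
have lbA : lbound A 0.
  by move=> _ [->|[q [q0 _] <-]]; rewrite ?ler0q//.
have infA : has_inf A by split; [exists 2; left|exists 0].
split=> [/(inf_lt infA.1)[_ [->|[q [q0 qF] <-]] lt]|[q [q0 qt qF]]].
- by move: lt; rewrite ltNge t2.
- by exists q.
- apply: le_lt_trans qt; apply: ge_inf; first exact: infA.2.
  by right; exists q.
Qed.

Let measurable_F q : measurable_fun setT (F q). Proof. by case: (FP q) => -[]. Qed.

Let F01 q b : 0 <= F q b <= 1. Proof. by case: (FP q) => -[]. Qed.

Let measurable_F_gt q : measurable [set z : B * measurableTypeR R | z.2 < F q z.1].
Proof.
rewrite -[X in measurable X]setTI; apply: measurable_fun_ltr.
- exact: measurable_snd.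
- by apply: measurableT_comp => //; exact: measurable_fst.
- exact: measurableT.
- by [].
Qed.

Lemma measurable_quantile : measurable_fun setT quantile.
Proof.
apply: (measurability _ (RGenInftyO.measurableE R)) => _ [_ [t ->] <-]; rewrite setTI.
have [t2|t2] := leP t 2; last first.
  rewrite (_ : _ @^-1` _ = setT)//; apply/seteqP; split=> // z _ /=.
  rewrite in_itv /=; apply: le_lt_trans t2; apply: ge_inf; last by left.
  by exists 0 => _ [->|[q [q0 _] <-]]; rewrite ?ler0q//.
rewrite (_ : _ @^-1` _ = \bigcup_n (if unpickle n is Some q then
    if (0 <= q :> rat) && (ratr q < t) then
      [set z | z.2 < F q z.1] else set0 else set0)).
  apply: bigcupT_measurable => n; case: unpickle => // q; case: ifP => // _;
    exact: measurable_F_gt.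
apply/seteqP; split=> z /=; rewrite in_itv /=.
  move=> /(quantile_lt _ t2)[q [q0 qt qF]]; exists (pickle q); first exact: I.
  by rewrite pickleK q0 qt.
move=> [n _]; case: unpickle => // q; case: ifP => // /andP[q0 qt] /= qF.
by apply/(quantile_lt _ t2); exists q.
Qed.

Let measurable_slice U : measurable U ->
    measurable_fun setT (fun b => unif R [set u | U (quantile (b, u))]).
Proof.
have [k kE] := random_kernel_exists measurable_quantile.
move=> mU; rewrite (_ : (fun _ => _) = k ^~ U); first exact: measurable_kernel.
by apply/funext => b; rewrite kE.
Qed.

Let ray t : measurable [set r : R | r < t].
Proof.
rewrite (_ : [set _ | _] = `]-oo, t[%classic); first exact: measurable_itv.
by apply/seteqP; split=> r /=; rewrite in_itv.
Qed.

Let measurable_uslice b U : measurable U ->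
    measurable [set u : measurableTypeR R | U (quantile (b, u))].
Proof.
move=> mU; have mf : measurable_fun setT (fun u => quantile (b, u)).
  by apply: measurableT_comp => //; exact: measurable_quantile.
by rewrite -[X in measurable X]setTI; exact: mf.
Qed.

(** The event [quantile (b, u) < t] is the union of the events [u < F q b] over
    the rational numbers [0 <= q < t].  Almost everywhere all these [F q b] are
    at most the conditional probability of [c < t], which bounds the left-hand
    side from above.  From below, the union contains [u < F q b] for a single
    [q], which may be taken as close to [t] as desired; the values of [F] on an
    exceptional set are thus harmless. *)
Lemma quantile_ray t A : measurable A ->
  (\int[omega]_(b in A) unif R [set u | (quantile (b, u) < t)%R] =
   p (below t `&` (dom X `&` proj X @^-1` A)))%E.
Proof.
move=> mA; have mE := @measurable_proj_preimage _ B X A mA.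
have [t2|t2] := leP t 2; last first.
  have -> : below t = setT.
    by apply/seteqP; split=> // x _; apply: le_lt_trans t2; have /andP[_ /le_trans] :=
      c01 x; apply; rewrite ler1n.
  rewrite setTI prob_over_proj// -[RHS]mul1e -integral_cst//; apply: eq_integral => b _.
  rewrite -(probability_setT (unif R)); congr (unif R _); apply/seteqP;
    split=> // u _ /=.
  apply: le_lt_trans t2; apply: ge_inf; last by left.
  by exists 0 => _ [->|[q [q0 _] <-]]; rewrite ?ler0q//.
have mslice : measurable_fun A (fun b => unif R [set u | (quantile (b, u) < t)%R]).
  by apply: measurable_funTS; exact: (measurable_slice (ray t)).
apply/eqP; rewrite eq_le; apply/andP; split.
  have [Ft FtP] := density_exists p (measurable_below t).
  have [[mFt Ft01] FtE] := FtP.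
  have mlt (t' : R) : measurable [set u : measurableTypeR R | u < t'].
    exact: ray.
  rewrite FtE//; apply: ae_ge0_le_integral => //.
  - by move=> b _; rewrite lee_fin; case/andP: (Ft01 b).
  - by apply/measurable_EFinP; exact: measurable_funTS.
  have : omega.-negligible (\bigcup_n (if unpickle n is Some q then
      if ratr q < t then [set b | Ft b < F q b] else set0 else set0)).
    apply: negligible_bigcup => n; case: unpickle => [q|]; last exact: negligible_set0.
    case: ifPn => qt; last exact: negligible_set0.
    apply/negligibleP.
      by rewrite -[X in measurable X]setTI;
        exact: (measurable_fun_ltr mFt (measurable_F q)).
    apply: (density_le (measurable_below (ratr q)) (measurable_below t) _ (FP q) FtP).
    by move=> x [/= xq _]; exact: lt_trans xq qt.
  apply: negligibleS => b /= nb; apply: contrapT => nN; apply: nb => _.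
  rewrite -unif_lt//; apply: le_measure; rewrite ?inE.
  - exact: (measurable_uslice b (ray t)).
  - exact: mlt.
  - move=> u /= /(quantile_lt _ t2)[q [q0 qt qF]]; apply: (lt_le_trans qF).
    rewrite leNgt; apply/negP => lt; apply: nN; exists (pickle q); first exact: I.
    by rewrite pickleK qt.
pose S n := below (t - n.+1%:R^-1) `&` (dom X `&` proj X @^-1` A).
have mS n : measurable (S n) by apply: measurableI => //; exact: measurable_below.
have US : \bigcup_n S n = below t `&` (dom X `&` proj X @^-1` A).
  apply/seteqP; split=> [x [n _ [xn Ex]]|x [xt Ex]].
    by split=> //; apply: (lt_le_trans xn); rewrite gerBl invr_ge0.
  have e0 : 0 < t - c x by rewrite subr_gt0.
  have [n _ /(_ n (leqnn n)) /= ne] := near_infty_natSinv_lt (PosNum e0).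
  exists n => //; split=> //; by rewrite /below /= ltrBrDr -ltrBrDl.
have ndS : nondecreasing_seq S.
  move=> n m nm; apply/subsetPset => x [xn Ex]; split=> //; apply: (lt_le_trans xn).
  by rewrite lerB// lef_pV2 ?posrE// ler_nat.
have := nondecreasing_cvg_mu (mu := p) mS (bigcupT_measurable _ mS) ndS.
rewrite US => cv; rewrite -(cvg_lim _ cv)//; apply: lime_le.
  by apply: cvgP cv.
near=> n => /=; rewrite /S.
have [le0|gt0] := leP (t - n.+1%:R^-1) 0.
  rewrite (_ : below _ = set0); first by rewrite set0I measure0 integral_ge0.
  by rewrite -subset0 => x /= xn; have /andP[] := c01 x; rewrite leNgt (lt_le_trans xn).
have [q /[!in_itv] /= /andP[nq qt]] : exists q, ratr q \in `](t - n.+1%:R^-1), t[.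
  by apply: rat_in_itvoo; rewrite gtrBl invr_gt0.
have q0 : 0 <= q by rewrite -(ler0q R) ltW// (lt_trans gt0).
apply: (@le_trans _ _ (p (below (ratr q) `&` (dom X `&` proj X @^-1` A)))).
  apply: le_measure; rewrite ?inE;
    [exact: mS|by apply: measurableI => //; exact: measurable_below|].
  by move=> x [xn Ex]; split=> //; exact: lt_trans xn nq.
have [_ FE] := FP q; rewrite FE//; apply: ge0_le_integral => //.
- by move=> b _; rewrite lee_fin; case/andP: (F01 q b).
- by apply/measurable_EFinP; exact: measurable_funTS.
- move=> b _; rewrite -unif_lt//; apply: le_measure; rewrite ?inE.
  + exact: ray.
  + exact: (measurable_uslice b (ray t)).
  + by move=> u /= uF; apply/(quantile_lt _ t2); exists q.
Unshelve. all: by end_near. Qed.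

(** Both sides are finite measures in [U], and open rays generate the Borel
    sets. *)
Lemma quantile_law U A : measurable U -> measurable A ->
  (\int[omega]_(b in A) unif R [set u | U (quantile (b, u))] =
   p (c @^-1` U `&` (dom X `&` proj X @^-1` A)))%E.
Proof.
move=> mU mA; have mE := @measurable_proj_preimage _ B X A mA.
have mq := measurable_quantile.
have [Q QE] := randomized_law_exists omega
  (@measurable_id _ (B * measurableTypeR R)%type setT).
have mAT : measurable (A `*` setT : set (B * measurableTypeR R)) by exact: measurableX.
have mqA : measurable_fun (A `*` setT) quantile by exact: measurable_funTS.
have mcE : measurable_fun (dom X `&` proj X @^-1` A) c by exact: measurable_funTS.
have [m1 m1E] := image_on_finite_measure Q mAT mqA.
have [m2 m2E] := image_on_finite_measure p mE mcE.
have m1I V : measurable V ->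
  m1 V = (\int[omega]_(b in A) unif R [set u | V (quantile (b, u))])%E.
  move=> mV; transitivity (Q ((A `*` setT) `&` quantile @^-1` V)); first exact: m1E.
  rewrite QE; last exact: mqA.
  rewrite [RHS]integral_mkcond; apply: eq_integral => b _; rewrite patchE;
    case: ifPn => bA.
    congr (unif R _); apply/seteqP; split=> [u [] //|u /= Vu]; split=> //; split=> //.
    exact: set_mem.
  rewrite (_ : [set _ | _] = set0) ?measure0//; rewrite -subset0 => u [[/= Ab _] _].
  by move: bA; rewrite mem_set.
rewrite -m1I// setIC -m2E.
apply: (@measure_unique _ R _ (@RGenInftyO.G R) (fun n => `]-oo,
  n%:R[%classic) _ _ _ _ m1 m2) => //.
- exact: RGenInftyO.measurableE.
- move=> _ _ [s ->] [t ->]; exists (Num.min s t); apply/seteqP.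
  by split=> x /=; rewrite !in_itv /= lt_min; [move=> [-> ->]|move=> /andP[-> ->]].
- by move=> n; exists n%:R.
- apply/seteqP; split=> // x _; exists (Num.bound `|x|) => //=.
  by rewrite in_itv /=; apply: le_lt_trans (ler_norm x) _;
    exact: archi_boundP (normr_ge0 x).
- move=> _ [t ->]; apply: (etrans (m1I _ (measurable_itv _))); apply/esym;
  apply: (etrans (m2E _)).
  rewrite setIC (_ : c @^-1` _ = below t); last first.
    by apply/seteqP; split=> x /=; rewrite in_itv.
  apply: (etrans (esym (quantile_ray t mA))).
  apply: eq_integral => b _; congr (unif R _).
- move=> n; rewrite ltey_eq; apply/orP; left; apply: fin_num_measure;
  exact: measurable_itv.
Qed.

End Disintegration.

(** Disintegrate the law of the code of a point along the base, and decode. *)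
Theorem rcp_exists (R : realType) d (B : measurableType d) (omega : probability B R)
    (X : borel_over R B) (p : prob_over omega X) : exists k, is_rcp p k.
Proof.
have D0 : dom X !=set0.
  apply/set0P/negP => /eqP D0; have := prob_over_dom p; rewrite D0 measure0 => /eqP.
  by rewrite eqe eq_sym oner_eq0.
have [c [r [mc mr c01 rD rc]]] := borel_retract (borel_over_standard X) D0.
have mq := measurable_quantile p mc.
have mrq : measurable_fun setT (r \o quantile p mc) by exact: measurableT_comp.
have [k kE] := random_kernel_exists mrq.
exists k; split=> [b|S T mS mT].
  by rewrite kE -(probability_setT (unif R)); congr (unif R _); apply/seteqP;
    split=> // u _; exact: rD.
under eq_integral do rewrite kE.
have mrS : measurable (r @^-1` S) by rewrite -[X in measurable X]setTI; exact: mr.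
have := quantile_law p mc c01 mrS mT => /= ->.
congr (p _); apply/seteqP; split=> x [Sx [Dx Tx]]; split=> //=; first by rewrite rc.
by move: Sx => /=; rewrite rc.
Qed.

(** * The relative product *)
Section RelativeProduct.
Context (R : realType) d (B : measurableType d) (omega : probability B R).

Lemma kernel_product_rect d1 d2 (T1 : measurableType d1) (T2 : measurableType d2)
    (k : R.-pker B ~> T1) (l : R.-pker B ~> T2) b S T : measurable S -> measurable T ->
  ((k b \x l b) (S `*` T) = k b S * l b T)%E.
Proof.
move=> mS mT; have l1 : l b setT = 1%E by exact: prob_kernel.
exact: (product_measure1E (k b) (of_mass1 l1) mS mT).
Qed.

(** The product of measures is measurable for the sigma-algebra generated by the
    evaluations, so the products of the kernels may be averaged in the Giry
    monad. *)
Lemma kernel_product_probability d1 d2 (T1 : measurableType d1) (T2 : measurableType d2)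
    (k : R.-pker B ~> T1) (l : R.-pker B ~> T2) :
  exists P : probability (T1 * T2)%type R, forall S, measurable S ->
    P S = (\int[omega]_b (k b \x l b) S)%E.
Proof.
have k1 b : k b setT = 1%E by exact: prob_kernel.
have l1 b : l b setT = 1%E by exact: prob_kernel.
pose K b : giry T1 R := of_mass1 (k1 b).
pose L b : giry T2 R := of_mass1 (l1 b).
have mK : measurable_fun setT K.
  by apply: measurable_giry_codensity => // S mS; exact: (measurable_kernel k).
have mL : measurable_fun setT L.
  by apply: measurable_giry_codensity => // S mS; exact: (measurable_kernel l).
have mKL : measurable_fun setT (fun b => giry_prod (K b, L b)).
  apply: measurableT_comp; first exact: measurable_giry_prod.
  exact: measurable_fun_pair.
pose M : giry (T1 * T2)%type R := giry_bind (omega : giry B R) mKL.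
have ME S : measurable S -> M S = (\int[omega]_b (k b \x l b) S)%E.
  move=> mS; have := @giry_int_bind _ _ B (T1 * T2)%type R (omega : giry B R) _ mKL
    (fun z => (\1_S z)%:E).
  rewrite /giry_int integral_indic// setIT => -> //.
  - by apply: eq_integral => b _; rewrite integral_indic// setIT.
  - by apply/measurable_EFinP; exact: measurable_indic.
have M1 : M setT = 1%E.
  rewrite ME//; under eq_integral =>
    b _ do rewrite -setXTT kernel_product_rect// k1 l1 mul1e.
  by rewrite integral_cst// mul1e; exact: probability_setT.
have [P PE] := probability_of M1; exists P => S mS; exact: (etrans (PE S) (ME S mS)).
Qed.

Lemma is_rcp_density (X : meas_over B) (p : prob_over omega X) k S : is_rcp p k ->
    measurable S ->
  is_density p S (fun b => fine (k b S)).
Proof.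
move=> [kD kE] mS.
have k1 b : k b setT = 1%E by exact: prob_kernel.
have kle b : (k b S <= 1)%E by rewrite -(k1 b); apply: le_measure; rewrite ?inE.
have kfin b : k b S \is a fin_num.
  by rewrite ge0_fin_numE// (le_lt_trans (kle b))// ltry.
split; last first.
  by move=> T mT; rewrite kE//; apply: eq_integral => b _; rewrite fineK.
split=> [|b]; last by rewrite fine_ge0//= -lee_fin fineK.
by apply: measurableT_comp => //; exact: (measurable_kernel k).
Qed.

Lemma rcp_rect (X Y : meas_over B) (p : prob_over omega X)
    (q : prob_over omega Y) k l S T :
  is_rcp p k -> is_rcp q l -> measurable S -> measurable T ->
  (\int[omega]_b (k b \x l b) (S `*` T) =
   \int[omega]_b (fine (k b S) * fine (l b T))%:E)%E.
Proof.
move=> pk ql mS mT; apply: eq_integral => b _; rewrite kernel_product_rect// EFinM.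
have fin d' (Z : measurableType d') (m : R.-pker B ~> Z) U : measurable U ->
  m b U \is a fin_num.
  move=> mU; rewrite ge0_fin_numE//; apply: (@le_lt_trans _ _ (m b setT)).
    by apply: le_measure; rewrite ?inE.
  by rewrite prob_kernel ltry.
by rewrite !fineK//; exact: fin.
Qed.

(** [density_le] is applied to the set itself in both directions. *)
Lemma density_ae_eq (X : meas_over B) (p : prob_over omega X) S f f' : measurable S ->
  is_density p S f -> is_density p S f' -> {ae omega, forall b, f b = f' b}.
Proof.
move=> mS pf pf'.
have mlt g h : is_density p S g -> is_density p S h -> measurable [set b | g b < h b].
  move=> [[mg _] _] [[mh _] _].
  by rewrite -[X in measurable X]setTI; exact: (measurable_fun_ltr mg mh).
have N1 := (negligibleP omega (mlt _ _ pf' pf)).2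
  (density_le mS mS (@subIsetl _ _ _) pf pf').
have N2 := (negligibleP omega (mlt _ _ pf pf')).2
  (density_le mS mS (@subIsetl _ _ _) pf' pf).
apply: negligibleS (negligibleU N1 N2) => b /= /eqP; rewrite neq_lt => /orP[];
  by [right|left].
Qed.

Lemma density_mul_int (X Y : meas_over B) (p : prob_over omega X)
    (q : prob_over omega Y) S T f f' g g' :
  measurable S -> measurable T ->
  is_density p S f -> is_density p S f' -> is_density q T g -> is_density q T g' ->
  (\int[omega]_b (f b * g b)%:E = \int[omega]_b (f' b * g' b)%:E)%E.
Proof.
move=> mS mT pf pf' qg qg'; apply: ge0_ae_eq_integral => //.
- by apply/measurable_EFinP; apply: measurable_funM; [case: pf.1|case: qg.1].
- by apply/measurable_EFinP; apply: measurable_funM; [case: pf'.1|case: qg'.1].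
- by move=> b _; rewrite lee_fin mulr_ge0//;
  [case/andP: (pf.1.2 b)|case/andP: (qg.1.2 b)].
- by move=> b _; rewrite lee_fin mulr_ge0//;
  [case/andP: (pf'.1.2 b)|case/andP: (qg'.1.2 b)].
have := negligibleU (density_ae_eq mS pf pf') (density_ae_eq mT qg qg').
apply: negligibleS => b /= nb; apply: contrapT => /not_orP[/contrapT fb /contrapT gb].
by apply: nb => _; rewrite fb gb.
Qed.
End RelativeProduct.

Section Family.
Context (R : realType) d (B : measurableType d) (sB : standard_borel R [set: B])
  (omega : probability B R).

(** The preimages of the rational rays under an injective measurable map to the
    line. *)
Lemma separating_sets : exists T : nat -> set B, (forall n, measurable (T n)) /\
  forall b b', b <> b' -> exists n, (T n b /\ ~ T n b') \/ (T n b' /\ ~ T n b).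
Proof.
have [c [r [mc _ _ _ rc]]] := borel_retract sB (ex_intro setT point I).
exists (fun n => if unpickle n is Some q then [set b | c b < ratr q] else set0); split.
  move=> n; case: unpickle => // q.
  by rewrite -[X in measurable X]setTI;
    exact: (measurable_fun_ltr mc (measurable_cst _)).
have sep b b' : c b < c b' -> exists n,
    (if unpickle n is Some q then [set b | c b < ratr q] else set0) b /\
    ~ (if unpickle n is Some q then [set b | c b < ratr q] else set0) b'.
  move=> /rat_in_itvoo[q]; rewrite in_itv /= => /andP[bq qb']; exists (pickle q).
  by rewrite pickleK /=; split; [exact: bq|apply/negP; rewrite -leNgt ltW].
move=> b b' bb'; have [/sep[n]|/sep[n]|cc] := ltgtP (c b) (c b').
- by move=> H; exists n; left.
- by move=> H; exists n; right.
- by case: bb'; rewrite -(rc b I) cc rc.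
Qed.

(** If [A] and [C] are disjoint subsets of the base, the rectangle of the parts
    of [X] over [A] and of [Y] over [C] has mass the integral of [\1_A * \1_C],
    which is [0].  Countably many of these rectangles cover the pairs with
    different base points, so the averaged product is carried by the fibre
    product. *)
Lemma relative_product_exists (X Y : borel_over R B) (p : prob_over omega X)
    (q : prob_over omega Y) :
  exists r : prob_over omega (fibre_product sB X Y), is_relative_product p q r.
Proof.
have [k pk] := rcp_exists p; have [l ql] := rcp_exists q.
have [P PE] := kernel_product_probability omega k l.
have Prect S T f g : measurable S -> measurable T -> is_density p S f ->
  is_density q T g ->
    P (S `*` T) = (\int[omega]_b (f b * g b)%:E)%E.
  move=> mS mT pf qg; rewrite PE; last exact: measurableX.
  rewrite (rcp_rect pk ql mS mT).
  exact: (density_mul_int mS mT (is_rcp_density pk mS) pf (is_rcp_density ql mT) qg).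
have mpX := @measurable_proj_preimage _ B X; have mpY :=
  @measurable_proj_preimage _ B Y.
have mfib := fibre_dom_measurable (X := X) (Y := Y) sB.
have null A C : measurable A -> measurable C -> A `&` C = set0 ->
    P ((dom X `&` proj X @^-1` A) `*` (dom Y `&` proj Y @^-1` C)) = 0%E.
  move=> mA mC AC; rewrite (Prect _ _ _ _ (mpX _ mA) (mpY _ mC) (density_proj p mA)
    (density_proj q mC)).
  apply: integral0_eq => b _; rewrite !indicE.
  case: (boolP (b \in A)) => [/set_mem Ab|]; last by rewrite mul0r.
  case: (boolP (b \in C)) => [/set_mem Cb|]; last by rewrite mulr0.
  by have : (A `&` C) b by []; rewrite AC.
have full : P (dom X `*` dom Y) = 1%E.
  have dX := density_proj p measurableT; have dY := density_proj q measurableT.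
  rewrite !preimage_setT !setIT in dX dY.
  rewrite (Prect _ _ _ _ (@dom_measurable _ _ X) (@dom_measurable _ _ Y) dX dY).
  under eq_integral => b _ do rewrite !indicE !in_setT mulr1.
  by rewrite integral_cst// mul1e; exact: probability_setT.
have P1 : P (fibre_dom (X := X) (Y := Y)) = 1%E.
  have [T [mT sepT]] := separating_sets.
  suff : P (~` fibre_dom (X := X) (Y := Y)) = 0%E.
    have := probability_setC P mfib => -> /eqP; rewrite sube_eq ?fin_num_measure//.
    by rewrite add0e => /eqP.
  have mXY : measurable (dom X `*` dom Y) by apply: measurableX; exact: dom_measurable.
  apply/(negligibleP P (measurableC mfib)).
  have n0 : P.-negligible (~` (dom X `*` dom Y)).
    apply/(negligibleP P (measurableC mXY)).
    by apply: (etrans (probability_setC P mXY)); rewrite full subee.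
  have n1 : P.-negligible (\bigcup_n
      ((dom X `&` proj X @^-1` T n) `*` (dom Y `&` proj Y @^-1` (~` T n)))).
    apply: negligible_bigcup => n; apply/negligibleP;
      last exact: null (mT n) (measurableC (mT n)) (setICr _).
    by apply: measurableX; [exact: mpX|apply: mpY; exact: measurableC].
  have n2 : P.-negligible (\bigcup_n
      ((dom X `&` proj X @^-1` (~` T n)) `*` (dom Y `&` proj Y @^-1` T n))).
    apply: negligible_bigcup => n; apply/negligibleP;
      last exact: null (measurableC (mT n)) (mT n) (setICl _).
    by apply: measurableX; [apply: mpX; exact: measurableC|exact: mpY].
  apply: negligibleS (negligibleU n0 (negligibleU n1 n2)) => -[x y] nf.
  have [[/= Dx Dy]|nD] := pselect ((dom X `*` dom Y) (x, y)); last by left.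
  right; have [n] := sepT (proj X x) (proj Y y) (fun e => nf (And3 Dx Dy e)).
  by move=> [[Tx nTy]|[Ty nTx]]; [left|right]; exists n.
have Pproj T : measurable T ->
  P (fibre_dom (X := X) (Y := Y) `&` (fun z => proj X z.1) @^-1` T) = omega T.
  move=> mT; transitivity (P
    (fibre_dom (X := X) (Y := Y) `&` ((dom X `&` proj X @^-1` T) `*` setT))).
    congr (P _); apply/seteqP; split=> -[x y] [[Dx Dy e] H]; first by split.
    by split=> //; case: H => -[].
  rewrite probability_full//; last by apply: measurableX => //; exact: mpX.
  rewrite (Prect _ _ _ _ (mpX _ mT) measurableT (density_proj p mT) (density_setT q)).
  by under eq_integral do rewrite mulr1; rewrite integral_indic// setIT.
exists (@ProbOver R d B omega (fibre_product sB X Y) P P1 Pproj); split.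
- by exists k.
- by exists l.
move=> k' l' pk' ql' S mS /=.
have [P' P'E] := kernel_product_probability omega k' l'.
rewrite -P'E//; apply: prod_measure_ext => // A C mA mC.
rewrite (Prect _ _ _ _ mA mC (is_rcp_density pk' mA) (is_rcp_density ql' mC)) P'E;
  last exact: measurableX.
by rewrite (rcp_rect pk' ql' mA mC).
Qed.

Lemma relative_product_rect (X Y : borel_over R B) (p : prob_over omega X)
    (q : prob_over omega Y)
    (r : prob_over omega (fibre_product sB X Y)) S T f g : is_relative_product p q r ->
  measurable S -> measurable T -> is_density p S f -> is_density q T g ->
  r (S `*` T) = (\int[omega]_b (f b * g b)%:E)%E.
Proof.
move=> [[k pk] [l ql] rE] mS mT pf qg.
rewrite (rE k l pk ql); last exact: measurableX.
rewrite (rcp_rect pk ql mS mT).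
exact: (density_mul_int mS mT (is_rcp_density pk mS) pf (is_rcp_density ql mT) qg).
Qed.

(** For the naturality of the relative product, the push-forward of [a p q] along
    [f] and [g] is compared with [a p' q'] on rectangles, where preimages under
    [f] and [g] have the same conditional probabilities
    ([density_preimage]). *)
Theorem relative_product_only_natural : exists a : prob_family sB omega,
  [/\ forall (X Y : borel_over R B) (p : prob_over omega X) (q : prob_over omega Y),
        is_relative_product p q (a X Y p q),
      prob_natural a &
      forall b : prob_family sB omega, prob_natural b ->
        forall (X Y : borel_over R B) (p : prob_over omega X) (q : prob_over omega Y) S,
        measurable S -> b X Y p q S = a X Y p q S].
Proof.
pose a : prob_family sB omega :=
  fun X Y p q => projT1 (cid (relative_product_exists p q)).
have aP (X Y : borel_over R B) (p : prob_over omega X) (q : prob_over omega Y) :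
  is_relative_product p q (a X Y p q) := projT2 (cid (relative_product_exists p q)).
exists a; split=> //; last first.
  move=> b nat_b X Y p q S mS; apply: prod_measure_ext => // A C mA mC.
  have [f pf] := density_exists p mA; have [g qg] := density_exists q mC.
  by rewrite (natural_rectangle nat_b mA mC pf qg)
    (relative_product_rect (aP X Y p q) mA mC pf qg).
move=> X X' Y Y' f g fover gover p p' q q' pp' qq' U mU.
have mfib := fibre_dom_measurable (X := X) (Y := Y) sB.
have [[mf fD fproj] [mg gD gproj]] := (fover, gover).
have mfg : measurable_fun (fibre_dom (X := X) (Y := Y)) (fun z => (f z.1, g z.2)).
  apply: measurable_fun_pair_on.
    apply: (measurable_comp (F := dom X)) => //; first exact: dom_measurable.
      by move=> _ [z [? _ _] <-].
    exact: measurable_funTS.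
  apply: (measurable_comp (F := dom Y)) => //; first exact: dom_measurable.
    by move=> _ [z [_ ? _] <-].
  exact: measurable_funTS.
have [nu nuE] := image_on_finite_measure (a X Y p q) mfib mfg.
have nu1 : nu setT = 1%E by rewrite nuE preimage_setT setIT;
  exact: (prob_over_dom (a X Y p q)).
have [P PE] := probability_of nu1.
apply: (etrans _ (nuE U)); apply: (etrans _ (PE U)).
apply: prod_measure_ext mU => A C mA mC.
have [h' p'h] := density_exists p' mA; have [h2 q'h] := density_exists q' mC.
rewrite (relative_product_rect (aP _ _ p' q') mA mC p'h q'h).
have mfA : measurable (dom X `&` f @^-1` A) by apply: mf => //; exact: dom_measurable.
have mgC : measurable (dom Y `&` g @^-1` C) by apply: mg => //; exact: dom_measurable.
have ph := density_preimage fover pp' mA p'h.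
have qh := density_preimage gover qq' mC q'h.
rewrite -(relative_product_rect (aP _ _ p q) mfA mgC ph qh).
apply/esym; apply: (etrans (PE _)); apply: (etrans (nuE _)).
apply: (etrans _ (probability_full mfib (measurableX mfA mgC)
  (prob_over_dom (a X Y p q)))).
congr (a X Y p q _); apply/seteqP; split=> -[x y] [[Dx Dy e] H]; split=> //.
  by case: H => ? ?; split.
by case: H => -[_ ?] [_ ?]; split.
Qed.

End Family.

Theorem theorem3p2 (R : realType) :
  (forall (d : measure_display) (B : measurableType d)
     (sB : standard_borel R [set: B]) (omega : probability B R),
     exists a : prob_family sB omega,
       [/\ forall (X Y : borel_over R B) (p : prob_over omega X)
             (q : prob_over omega Y), is_relative_product p q (a X Y p q),
           prob_natural a &
           forall b : prob_family sB omega, prob_natural b ->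
             forall (X Y : borel_over R B) (p : prob_over omega X)
               (q : prob_over omega Y) S, measurable S ->
               b X Y p q S = a X Y p q S])
  /\
  (forall (B : Type) (omega : distr R B),
     exists a : distr_family omega (fun X : set_over B => X),
       [/\ forall (X Y : set_over B) (p : distr_over omega X)
             (q : distr_over omega Y) z, a X Y p q z = drelative_product p q z,
           distr_natural a &
           forall b : distr_family omega (fun X : set_over B => X), distr_natural b ->
             forall (X Y : set_over B) (p : distr_over omega X)
               (q : distr_over omega Y), b X Y p q = a X Y p q])
  /\
  (forall (B : finType) (omega : distr R B),
     exists a : distr_family omega (@set_of_fin B),
       [/\ forall (X Y : fin_over B) (p : distr_over omega (set_of_fin X))
             (q : distr_over omega (set_of_fin Y)) z,
             a X Y p q z = drelative_product p q z,
           distr_natural a &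
           forall b : distr_family omega (@set_of_fin B), distr_natural b ->
             forall (X Y : fin_over B) (p : distr_over omega (set_of_fin X))
               (q : distr_over omega (set_of_fin Y)),
               b X Y p q = a X Y p q]).
Proof.
split; first by move=> d B sB omega; exact: relative_product_only_natural.
split=> B omega.
  exact: (@drelative_product_only_natural R B omega _ (fun X => X)
    (SetOver (@fst B 'I_3))
    (fun b i => (b, i)) snd (fun _ _ => erefl) (fun _ _ => erefl)
    (fun '(b, i) => erefl)).
exact: (@drelative_product_only_natural R B omega _ (@set_of_fin B)
  (@FinOver B (B * 'I_3)%type fst) (fun b i => (b, i)) snd
  (fun _ _ => erefl) (fun _ _ => erefl) (fun '(b, i) => erefl)).
Qed.
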